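(* Let $d\in\mathbb{N}^+$, $\alpha,\lambda,\mu>0$, and let $p(0,t)$ be the probability that the process $\mathcal N$ (defined in the context), started at the origin $0$, is at the origin at time $t$. For $t\ge 0$, $$p(0,t)=\begin{cases}\displaystyle 1-d\sum_{j=1}^{+\infty}(1-d)^{j-1}F_Y^{(j)}(t), & \lambda\ge\mu,\\[2mm] \displaystyle 1-d\sum_{j=1}^{+\infty}(1-d)^{j-1}\left[1-\left(\frac{\mu-\lambda}{\mu}\right)^{\frac{\alpha}{\lambda}}\right]^jF_Y^{(j)}(t), & \lambda<\mu,\end{cases}$$ where $F_Y^{(j)}(t)=\mathbb P(Y_1+\cdots+Y_j\le t)$ with $Y_1,Y_2,\ldots$ i.i.d. nonnegative random variables having distribution function $$F_Y^{(1)}(t)=\begin{cases}\displaystyle 1-\left(\frac{\lambda-\mu}{\lambda e^{(\lambda-\mu)t}-\mu}\right)^{\frac{\alpha}{\lambda}}, & \lambda>\mu,\\[2mm] \displaystyle 1-\frac{1}{(1+\lambda t)^{\frac{\alpha}{\lambda}}}, & \lambda=\mu,\\[2mm] \displaystyle \frac{1}{1-\left(1-\frac{\lambda}{\mu}\right)^{\frac{\alpha}{\lambda}}}\left[1-\left(\frac{\mu-\lambda}{\mu-\lambda e^{-(\mu-\lambda)t}}\right)^{\frac{\alpha}{\lambda}}\right], & \lambda<\mu,\end{cases}\qquad t\ge 0.$$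
   Context: Let $D=\{1,\ldots,d\}$. $\mathcal N=\{(N(t),J(t)),t\ge 0\}$ is the (nonexplosive) continuous-time Markov chain on $S=\{(0,0)\}\cup(\mathbb N^+\times D)$ whose only nonzero off-diagonal transition rates are, for $k\in\mathbb N^+$ and $j\in D$: from $(0,0)$ to $(1,j)$ at rate $\alpha$; from $(k,j)$ to $(k+1,j)$ at rate $\alpha+\lambda k$; from $(k,j)$ to $(k-1,j)$ at rate $\mu k$, where $(0,j)$ is identified with $(0,0)$ for every $j$. The state $(0,0)$ is denoted $0$, and the initial state is $0$. Then $p(0,t)=\mathbb P\{(N(t),J(t))=0\mid (N(0),J(0))=0\}$. The convention $0^0=1$ is used. *)

(* Defs.v *)
From HB Require Import structures.
From mathcomp Require Import all_boot all_order all_algebra.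
From mathcomp Require Import all_classical all_reals all_analysis.

Set Implicit Arguments.
Unset Strict Implicit.
Unset Printing Implicit Defensive.
Import Order.TTheory GRing.Theory Num.Theory.
Import numFieldNormedType.Exports.

Local Open Scope classical_set_scope.
Local Open Scope ring_scope.

(* Only meaningful when B has positive probability; it is 0 when P B = 0. *)
Definition cond_prob (R : realType) (dT : measure_display)
    (T : measurableType dT) (P : probability T R) (A B : set T) : R :=
  fine (P (A `&` B)) / fine (P B).

(* A right-continuous path on [0, +oo[ that is piecewise constant, with
   finitely many jumps before any finite time. *)
Definition step_path (R : realType) (S : Type) (f : R -> S) : Prop :=
  forall b : R, 0 < b ->
  exists (n : nat) (tau : nat -> R),
    [/\ tau 0%N = 0, tau n = b &
        forall k, (k < n)%N -> tau k <= tau k.+1 /\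
          forall t, tau k <= t -> t < tau k.+1 -> f t = f (tau k)].

(* Honest (mass-preserving) transition functions p t x y, for t >= 0. *)
Definition transition_function (R : realType) (S : countType)
    (p : R -> S -> S -> R) : Prop :=
  [/\ forall t x y, 0 <= t -> 0 <= p t x y,
      forall t x, 0 <= t -> \esum_(y in [set: S]) (p t x y)%:E = 1%E,
      forall x y, p 0 x y = (x == y)%:R &
      forall s t x y, 0 <= s -> 0 <= t ->
        (p (s + t) x y)%:E = \esum_(z in [set: S]) (p s x z * p t z y)%:E].

(* p has off-diagonal rates q, and the total rate out of each state is the sum
   of the off-diagonal ones; the diagonal values of q are not used. *)
Definition has_rates (R : realType) (S : countType)
    (p : R -> S -> S -> R) (q : S -> S -> R) : Prop :=
  (forall x y, x != y -> p h x y / h @[h --> 0^'+] --> q x y) /\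
  (forall x, ((1 - p h x x) / h)%:E @[h --> 0^'+] -->
             \esum_(y in [set~ x]) (q x y)%:E).

Definition markov_with (R : realType) (dT : measure_display)
    (T : measurableType dT) (P : probability T R) (S : countType)
    (X : R -> T -> S) (p : R -> S -> S -> R) : Prop :=
  forall (n : nat) (t : nat -> R) (x : nat -> S),
    0 <= t 0%N -> (forall k, t k <= t k.+1) ->
    let past := \bigcap_(k in `I_n.+1) (X (t k) @^-1` [set x k]) in
    (0 < P past)%E ->
    cond_prob P (X (t n.+1) @^-1` [set x n.+1]) past =
      p (t n.+1 - t n) (x n) (x n.+1).

(* Nonexplosive time-homogeneous continuous-time Markov chain (X t), t >= 0,
   on the countable set S with off-diagonal transition rates q. *)
Definition ctmc (R : realType) (dT : measure_display)
    (T : measurableType dT) (P : probability T R) (S : countType)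
    (q : S -> S -> R) (X : R -> T -> S) : Prop :=
  [/\ forall t x, 0 <= t -> measurable (X t @^-1` [set x]),
      {ae P, forall w, step_path (X ^~ w)} &
      exists p, [/\ transition_function p, has_rates p q & markov_with P X p]].

(* None is (0,0); Some (n, j) is (n+1, j), so that no state (0, j) occurs.
   The phases are numbered from 0. *)
Definition state (d : nat) : Type := option (nat * 'I_d).
HB.instance Definition _ (d : nat) := Countable.on (state d).

Definition origin (d : nat) : state d := None.

(* The state (k, j), with every (0, j) identified with (0,0). *)
Definition st (d : nat) (k : nat) (j : 'I_d) : state d :=
  if k is n.+1 then Some (n, j) else origin d.

Definition rate (R : realType) (d : nat) (alpha lambda mu : R)
    (x y : state d) : R :=
  match x with
  | None => if [exists j : 'I_d, y == st 1 j] then alpha else 0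
  | Some (n, j) =>
      let k := n.+1 in
      if y == st k.+1 j then alpha + lambda * k%:R
      else if y == st k.-1 j then mu * k%:R
      else 0
  end.

Definition p0 (R : realType) (d : nat) (dT : measure_display)
    (T : measurableType dT) (P : probability T R)
    (X : R -> T -> state d) (t : R) : R :=
  cond_prob P (X t @^-1` [set origin d]) (X 0 @^-1` [set origin d]).

Definition FY (R : realType) (alpha lambda mu : R) (t : R) : R :=
  if mu < lambda then
    1 - ((lambda - mu) / (lambda * expR ((lambda - mu) * t) - mu))
          `^ (alpha / lambda)
  else if lambda == mu then
    1 - 1 / (1 + lambda * t) `^ (alpha / lambda)
  else
    1 / (1 - (1 - lambda / mu) `^ (alpha / lambda)) *
    (1 - ((mu - lambda) / (mu - lambda * expR (- (mu - lambda) * t)))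
           `^ (alpha / lambda)).

Definition mutually_independent (R : realType) (dT : measure_display)
    (T : measurableType dT) (P : probability T R)
    (Y : nat -> {RV P >-> R}) : Prop :=
  forall (I : seq nat) (B : nat -> set R),
    uniq I -> (forall i, measurable (B i)) ->
    P (\bigcap_(i in [set` I]) (Y i @^-1` B i)) =
    (\prod_(i <- I) P (Y i @^-1` B i))%E.

(* Y 0, Y 1, ... play the roles of Y_1, Y_2, ... *)
Definition Fsum (R : realType) (dT : measure_display)
    (T : measurableType dT) (P : probability T R)
    (Y : nat -> {RV P >-> R}) (j : nat) (t : R) : R :=
  fine (P [set w | \sum_(i < j) Y i w <= t]).

(* Main.v *)
Require Import Defs.
From HB Require Import structures.
From mathcomp Require Import all_boot all_order all_algebra.
From mathcomp Require Import all_classical all_reals all_analysis.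
From mathcomp Require Import measurable_realfun ring lra.

Set Implicit Arguments.
Unset Strict Implicit.
Unset Printing Implicit Defensive.
Import Order.TTheory GRing.Theory Num.Theory.
Import numFieldNormedType.Exports.

Local Open Scope classical_set_scope.
Local Open Scope ring_scope.

(* Let p1 be the probability that the chain with d = 1 is at 0 at time t; it is
   theta^(alpha/lambda), where theta solves a logistic equation, and the
   distribution at time t is negative binomial with mass function [pascal].
   By symmetry in the phases, the return probability p and the sums V_k, over
   the phases j, of the probabilities of being at 0 after time t from (k, j)
   satisfy the backward equations.  Differentiating the pairing
   sum_k pascal_k(s) V_k(t - s) in s compares the two chains: only the terms
   k = 0 do not cancel, and after an integration by parts this gives
     p = p1 + (d - 1) int_0^t p1'(s) p(t - s) ds,
   so that H = 1 - p satisfies H = d F - (d - 1) f * H with F = 1 - p1, f = F'.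
   On the other hand F is c times the distribution function of Y_1 (c = 1 for
   lambda >= mu), so that G_j = c^j F_Y^(j) satisfies G_(j+1) = f * G_j, and
   the series in the statement is the Neumann series of the equation for H.
   The error terms of the partial sums decay geometrically in a norm weighted
   by exp(- L t). *)

(** * Preliminaries on derivatives and limits *)

Lemma is_derive_ext {R : realType} (f g : R -> R) (s df dg : R) :
  is_derive s 1 f df -> f =1 g -> df = dg -> is_derive s 1 g dg.
Proof. by move=> + /funext <- <-. Qed.

Lemma cvg_sum_seq {R : realType} {T : Type} {I : eqType} (F : set_system T)
    {FF : Filter F} (r : seq I) (f : I -> T -> R) (l : I -> R) :
  (forall i, i \in r -> f i @ F --> l i) ->
  \sum_(i <- r) f i x @[x --> F] --> \sum_(i <- r) l i.
Proof.
elim: r => [_|i r IH fl].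
  by rewrite big_nil; under eq_fun do rewrite big_nil; exact: cvg_cst.
rewrite big_cons; under eq_fun do rewrite big_cons.
apply: cvgD; first by apply: fl; rewrite mem_head.
by apply: IH => j jr; apply: fl; rewrite in_cons jr orbT.
Qed.

Lemma is_derive_expRl {R : realType} (c t : R) :
  is_derive t 1 (fun s => expR (c * s)) (c * expR (c * t)).
Proof.
have h : is_derive t 1 ( *%R c) c.
  have := @is_deriveZ _ _ _ id c t 1 1 _.
  by rewrite /GRing.scale/= mulr1; apply.
have := @is_derive1_comp _ expR ( *%R c) t _ _ (is_derive_expR _) h.
by rewrite mulrC.
Qed.

(** * The empty probability of the chain with one phase *)

Section immigration_law.
Context {R : realType} (alpha lambda mu : R).
Hypotheses (alpha_gt0 : 0 < alpha) (lambda_gt0 : 0 < lambda) (mu_gt0 : 0 < mu).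

(* The solution of y' = (lambda - mu) y + mu with y(0) = 1. *)
Definition growth (t : R) : R :=
  if lambda == mu then 1 + lambda * t
  else (lambda * expR ((lambda - mu) * t) - mu) / (lambda - mu).

Lemma growth_ode (t : R) :
  lambda * expR ((lambda - mu) * t) = (lambda - mu) * growth t + mu.
Proof.
rewrite /growth; case: ifPn => [/eqP ->|lm].
  by rewrite subrr !mul0r expR0; ring.
by rewrite [_ * (_ / _)]mulrC divfK ?subr_eq0// subrK.
Qed.

Lemma is_derive_growth (t : R) :
  is_derive t 1 growth (lambda * expR ((lambda - mu) * t)).
Proof.
have [lm|lm] := eqVneq lambda mu.
  have -> : growth = cst 1 \+ (lambda \*: id).
    by apply/funext => s; rewrite /growth lm eqxx.
  apply: is_derive_eq.
  by rewrite lm subrr mul0r expR0 add0r.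
have -> : growth = (lambda - mu)^-1 \*:
    (lambda \*: (fun s => expR ((lambda - mu) * s)) \- cst mu).
  by apply/funext => s; rewrite /growth (negbTE lm)/= mulrC.
have ? := is_derive_expRl (lambda - mu) t.
apply: is_derive_eq.
by rewrite /GRing.scale/= subr0 (mulrCA lambda) mulKf// subr_eq0.
Qed.

Lemma growth_nd (s t : R) : s <= t -> growth s <= growth t.
Proof.
move=> st; rewrite /growth; case: ifPn => [_|lm].
  by rewrite lerD2l ler_wpM2l// ltW.
have [ml|ml|/eqP] := ltgtP mu lambda; last by rewrite eq_sym (negbTE lm).
  rewrite ler_wpM2r ?invr_ge0 ?subr_ge0 ?(ltW ml)// lerD2r.
  by rewrite ler_wpM2l ?(ltW lambda_gt0)// ler_expR ler_wpM2l// subr_ge0 ltW.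
(* For lambda < mu the exponential decreases and the divisor is negative; the two reversals
   cancel. *)
rewrite ler_nM2r ?invr_lt0 ?subr_lt0// lerD2r.
by rewrite ler_wpM2l ?(ltW lambda_gt0)// ler_expR ler_nM2l// subr_lt0.
Qed.

Lemma growth0 : growth 0 = 1.
Proof.
rewrite /growth mulr0 mulr0 addr0 expR0 mulr1; case: ifPn => // lm.
by rewrite divff// subr_eq0.
Qed.

Lemma growth_ge1 (t : R) : 0 <= t -> 1 <= growth t.
Proof. by move=> t0; rewrite -growth0 growth_nd. Qed.

(** The success parameter of the negative binomial law of the one-phase chain. As the reciprocal of
    a solution of a linear equation it solves a logistic one. *)
Definition theta (t : R) : R := (growth t)^-1.

Lemma theta_gt0 (t : R) : 0 <= t -> 0 < theta t.
Proof. by move=> t0; rewrite invr_gt0 (lt_le_trans _ (growth_ge1 t0)). Qed.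

Lemma theta_le1 (t : R) : 0 <= t -> theta t <= 1.
Proof. by move=> t0; rewrite invf_le1 ?(lt_le_trans _ (growth_ge1 t0))// growth_ge1. Qed.

Lemma theta0 : theta 0 = 1.
Proof. by rewrite /theta growth0 invr1. Qed.

Lemma theta_ni (s t : R) : 0 <= s -> s <= t -> theta t <= theta s.
Proof.
move=> s0 st; rewrite lef_pV2 ?growth_nd// posrE.
  by rewrite (lt_le_trans _ (growth_ge1 (le_trans s0 st))).
by rewrite (lt_le_trans _ (growth_ge1 s0)).
Qed.

Lemma is_derive_theta (t : R) : 0 <= t ->
  is_derive t 1 theta (- (theta t * (lambda - mu + mu * theta t))).
Proof.
move=> t0; have g0 : growth t != 0.
  by rewrite gt_eqF// (lt_le_trans _ (growth_ge1 t0)).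
have dg := is_derive_growth t.
apply: DeriveDef.
  by apply: derivableV => //; case: dg.
rewrite deriveV//.
rewrite derive_val growth_ode /theta /GRing.scale/=.
by field.
Qed.

Let a : R := alpha / lambda.

Let a_gt0 : 0 < a. Proof. exact: divr_gt0. Qed.

Definition idle (t : R) : R := theta t `^ a.

Definition idle_density (t : R) : R := a * idle t * (lambda - mu + mu * theta t).

Lemma idle_gt0 (t : R) : 0 <= t -> 0 < idle t.
Proof. by move=> t0; rewrite powR_gt0// theta_gt0. Qed.

Lemma idle_le1 (t : R) : 0 <= t -> idle t <= 1.
Proof.
move=> t0; have <- : 1 `^ a = 1 :> R by rewrite powR1.
rewrite /idle ge0_ler_powR ?nnegrE ?(ltW a_gt0)//.
  by rewrite ltW// theta_gt0.
exact: theta_le1.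
Qed.

Lemma idle0 : idle 0 = 1.
Proof. by rewrite /idle theta0 powR1. Qed.

Lemma is_derive_idle (t : R) : 0 <= t -> is_derive t 1 idle (- idle_density t).
Proof.
move=> t0; have th0 := theta_gt0 t0.
have dth := is_derive_theta t0.
have dp : is_derive (theta t) 1 (fun x : R => x `^ a) (a * theta t `^ (a - 1)).
  exact: is_derive1_powR.
rewrite (_ : - _ = a * theta t `^ (a - 1) *
    - (theta t * (lambda - mu + mu * theta t))); last first.
  by rewrite /idle_density /idle -(@mulr_powRB1 _ (theta t) a) ?ltW//; ring.
exact: (@is_derive1_comp _ (fun x : R => x `^ a) theta t _ _ dp dth).
Qed.

(** For lambda < mu the sign of the last factor is not visible; it is the logarithmic derivative of
    [growth], hence positive. *)
Lemma idle_density_ge0 (t : R) : 0 <= t -> 0 <= idle_density t.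
Proof.
move=> t0; have p0 := idle_gt0 t0; have th0 := theta_gt0 t0.
have g0 : growth t != 0.
  by rewrite gt_eqF// (lt_le_trans _ (growth_ge1 t0)).
rewrite /idle_density.
have -> : lambda - mu + mu * theta t = lambda * expR ((lambda - mu) * t) * theta t.
  by rewrite growth_ode /theta; field.
by apply: ltW; rewrite mulr_gt0 ?(mulr_gt0 a_gt0)// mulr_gt0// mulr_gt0// expR_gt0.
Qed.

(** The last factor is at most lambda because [theta] is at most 1. This uniform bound becomes the
    constant [C] of [conv_bound]. *)
Lemma idle_density_le (t : R) : 0 <= t -> idle_density t <= alpha.
Proof.
move=> t0; have p1 := idle_le1 t0; have p0 := idle_gt0 t0.
have := theta_le1 t0 => th1; have th0 := theta_gt0 t0.
have la : lambda - mu + mu * theta t <= lambda.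
  have := ler_wpM2l (ltW mu_gt0) th1; lra.
apply: (@le_trans _ _ (a * idle t * lambda)).
  by rewrite ler_wpM2l// mulr_ge0// ltW.
rewrite /a -[leRHS]mulr1 mulrAC divfK ?gt_eqF//.
by rewrite ler_wpM2l// ltW.
Qed.

Lemma continuous_theta (t : R) : 0 <= t -> {for t, continuous theta}.
Proof.
move=> t0; apply/differentiable_continuous/derivable1_diffP.
by case: (is_derive_theta t0).
Qed.

Lemma continuous_idle (t : R) : 0 <= t -> {for t, continuous idle}.
Proof.
move=> t0; apply/differentiable_continuous/derivable1_diffP.
by case: (is_derive_idle t0).
Qed.

(** [theta] is controlled only at nonnegative times; the absolute value extends the density to a
    kernel continuous on the whole line. *)
Lemma continuous_idle_density_norm : continuous (fun t : R => idle_density `|t| : R).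
Proof.
move=> t; apply: (@cvg_comp _ _ _ (fun s : R => `|s|) idle_density _ (nbhs `|t|)).
  by apply: cvg_norm; exact: cvg_id.
apply: cvgM.
  by apply: cvgM; [exact: cvg_cst|exact: continuous_idle].
apply: cvgD; first exact: cvg_cst.
by apply: cvgM; [exact: cvg_cst|exact: continuous_theta].
Qed.

(* The limit of [1 - idle] at infinity, by which F_Y is normalised. *)
Definition busy_mass : R :=
  if mu <= lambda then 1 else 1 - ((mu - lambda) / mu) `^ a.

Lemma busy_mass_gt0 : 0 < busy_mass.
Proof.
rewrite /busy_mass; case: ifPn => [_|]; first exact: ltr01.
rewrite -ltNge => lm.
rewrite subr_gt0.
have <- : 1 `^ a = 1 :> R by rewrite powR1.
rewrite gt0_ltr_powR ?nnegrE//.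
  by rewrite divr_ge0// ?subr_ge0 ltW.
by rewrite ltr_pdivrMr// mul1r ltrBlDr ltrDl.
Qed.

(** Multiplying by [busy_mass] removes the normalising constant of the case lambda < mu, so that the
    three regimes are given by one formula. *)
Lemma FY_idle (t : R) : 0 <= t -> busy_mass * FY alpha lambda mu t = 1 - idle t.
Proof.
move=> t0; have := busy_mass_gt0; rewrite /busy_mass /FY /idle /theta /growth -/a.
have [ml|ml|<-] := ltgtP mu lambda => c0.
- by rewrite mul1r invf_div.
- rewrite invf_div.
  have -> : 1 - lambda / mu = (mu - lambda) / mu.
    by rewrite mulrBl divff// gt_eqF.
  rewrite mulrA mulrC mul1r divff ?gt_eqF// mulr1; congr (1 - _ `^ _).
  rewrite -(opprB mu lambda) -(opprB mu (lambda * _)) invrN mulrNN.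
  by rewrite mulNr.
- rewrite mul1r mul1r; congr (1 - _).
  rewrite -!powR_inv1 ?powR_ge0//; last first.
    by rewrite addr_ge0// mulr_ge0// ltW.
  exact: powRAC.
Qed.

End immigration_law.

(** * Backward equations *)

Lemma cvg_close {R : realType} {T : Type} (F : set_system T) {FF : Filter F}
    (f g r : T -> R) (l : R) :
  (\forall x \near F, `|f x - g x| <= r x) -> g @ F --> l -> r @ F --> 0 ->
  f @ F --> l.
Proof.
move=> fg gl r0; rewrite (_ : f = (f \- g) \+ g); last first.
  by apply/funext => x /=; rewrite subrK.
rewrite -[l]add0r; apply: cvgD => //.
apply/cvgr0Pnorm_le => e e0; move/cvgr0Pnorm_le : r0 => /(_ _ e0) r0.
near=> x; apply: (@le_trans _ _ (r x)) => /=; first by near: x.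
by rewrite (le_trans (ler_norm _))//; near: x.
Unshelve. all: by end_near. Qed.

Lemma sum_le_esum {R : realType} {S : choiceType} (a : S -> R) (s : seq S) :
  uniq s -> (forall y, 0 <= a y) ->
  ((\sum_(y <- s) a y)%:E <= \esum_(y in [set: S]) (a y)%:E)%E.
Proof.
move=> us a0; apply: esum_ge; exists [set` s]; first by split.
by rewrite -fsbig_seq// sumEFin.
Qed.

Section backward_equation.
Context {R : realType} {S : countType} (p : R -> S -> S -> R).
Hypothesis p_trans : transition_function p.

Let p_ge0 (t : R) (x y : S) : 0 <= t -> 0 <= p t x y.
Proof. by case: p_trans => + _ _ _; apply. Qed.

Let p_sum1 (t : R) (x : S) : 0 <= t -> \esum_(y in [set: S]) (p t x y)%:E = 1%E.
Proof. by case: p_trans => _ + _ _; apply. Qed.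

Lemma transition_le1 (t : R) (x y : S) : 0 <= t -> p t x y <= 1.
Proof.
move=> t0; have := @sum_le_esum R S (p t x) [:: y] isT (fun z => p_ge0 x z t0).
by rewrite p_sum1// big_seq1 lee_fin.
Qed.

(* The probability of having left [x] for a state outside [N] after time [h]. *)
Definition escape (N : seq S) (x : S) (h : R) : R :=
  1 - p h x x - \sum_(y <- N) p h x y.

Section increments.
Variables (N : seq S) (x : S).
Hypotheses (N_uniq : uniq N) (xN : x \notin N).

Lemma escape_ge0 (h : R) : 0 <= h -> 0 <= escape N x h.
Proof.
move=> h0; have := @sum_le_esum R S (p h x) (x :: N) _ (fun z => p_ge0 x z h0).
rewrite p_sum1// big_cons/= xN/= lee_fin => /(_ N_uniq).
by rewrite /escape -addrA -opprD subr_ge0.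
Qed.

(* The upper bound is Chapman-Kolmogorov for the complementary probability
   [1 - p (h + t) x z], in which only the states of [x :: N] are kept. *)
Lemma transition_increment (z : S) (h t : R) : 0 <= h -> 0 <= t ->
  `|p (h + t) x z - p t x z - \sum_(y <- N) p h x y * (p t y z - p t x z)|
    <= escape N x h.
Proof.
move=> h0 t0; have uN : uniq (x :: N) by rewrite /= xN.
have CK : \esum_(y in [set: S]) (p h x y * p t y z)%:E = (p (h + t) x z)%:E.
  by case: p_trans => _ _ _ ->.
have pu0 y : 0 <= p h x y * p t y z by rewrite mulr_ge0 ?p_ge0.
have pv0 y : 0 <= p h x y * (1 - p t y z).
  by rewrite mulr_ge0 ?p_ge0// subr_ge0 transition_le1.
have lo := sum_le_esum uN pu0; have hi := sum_le_esum uN pv0.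
(* The two series add up to the total mass 1, so a lower bound for the second is an upper bound for
   [p (h + t) x z]. *)
have split1 : (\esum_(y in [set: S]) (p h x y * p t y z)%:E +
   \esum_(y in [set: S]) (p h x y * (1 - p t y z))%:E = 1)%E.
  rewrite -esumD; last 2 first.
  - by move=> y _; rewrite lee_fin.
  - by move=> y _; rewrite lee_fin.
  rewrite -(p_sum1 x h0); apply: eq_esum => y _.
  by rewrite -EFinD; congr EFin; ring.
rewrite CK lee_fin big_cons in lo.
have {}hi : p h x x * (1 - p t x z) + \sum_(y <- N) p h x y * (1 - p t y z) <=
    1 - p (h + t) x z.
  rewrite -lee_fin EFinB -split1 CK.
  rewrite [(_ + _ - _)%E]addeC addeA -EFinN -EFinD addNr add0e.
  by rewrite big_cons in hi.
have sB : \sum_(y <- N) p h x y * (1 - p t y z) =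
    \sum_(y <- N) p h x y - \sum_(y <- N) p h x y * p t y z.
  by rewrite -sumrB; apply: eq_bigr => y _; rewrite mulrBr mulr1.
have sD : \sum_(y <- N) p h x y * (p t y z - p t x z) =
    \sum_(y <- N) p h x y * p t y z - (\sum_(y <- N) p h x y) * p t x z.
  by rewrite mulr_suml -sumrB; apply: eq_bigr => y _; rewrite mulrBr.
rewrite sB in hi; rewrite sD; have := escape_ge0 h0.
have := p_ge0 x z t0; have := transition_le1 x z t0; rewrite /escape.
move: (\sum_(y <- N) p h x y) (\sum_(y <- N) p h x y * p t y z) hi lo => s su hi lo.
(* The difference lies between [- escape N x h * p t x z] and [escape N x h * (1 - p t x z)]. *)
move=> p1 p0 r0; rewrite ler_norml; apply/andP; split; nra.
Qed.

End increments.

Variable q : S -> S -> R.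
Hypothesis p_rates : has_rates p q.

Section derivative.
Variables (N : seq S) (x : S).
Hypotheses (N_uniq : uniq N) (xN : x \notin N) (q_ge0 : forall y, 0 <= q x y).
Hypothesis q_out : forall y, y != x -> y \notin N -> q x y = 0.

Lemma esum_rates : \esum_(y in [set~ x]) (q x y)%:E = (\sum_(y <- N) q x y)%:E.
Proof.
rewrite (esumID [set` N])//; last by move=> y _; rewrite lee_fin.
rewrite [X in (_ + X)%E]esum1 ?adde0; last first.
  by move=> y [/eqP yx /negP yN]; rewrite q_out.
rewrite (_ : _ `&` _ = [set` N]); last first.
  apply/seteqP; split=> [y []//|y yN]; split=> //.
  by move=> yx; move: yN; rewrite yx/= (negbTE xN).
rewrite esum_fset; [|exact: finite_seq|by move=> y _; rewrite lee_fin].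
by rewrite -fsbig_seq// sumEFin.
Qed.

Lemma cvg_exit_rate :
  (1 - p h x x) / h @[h --> 0^'+] --> \sum_(y <- N) q x y.
Proof.
case: p_rates => _ /(_ x); rewrite esum_rates => /fine_cvgP[_].
exact.
Qed.

Lemma cvg_sum_rates (w : S -> R -> R) (l : S -> R) :
  (forall y, y \in N -> w y h @[h --> 0^'+] --> l y) ->
  \sum_(y <- N) p h x y / h * w y h @[h --> 0^'+] --> \sum_(y <- N) q x y * l y.
Proof.
move=> wl; apply: cvg_sum_seq => y yN; apply: cvgM; last exact: wl.
case: p_rates => + _; apply.
by apply: contraNneq xN => ->.
Qed.

(** The total exit rate is the sum of the rates into [N], so the first-order terms cancel. The error
    in [transition_increment] is therefore o(h). *)
Lemma cvg_escape_rate : escape N x h / h @[h --> 0^'+] --> 0.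
Proof.
rewrite -[X in _ --> X](subrr (\sum_(y <- N) q x y)).
rewrite (_ : (fun h => _) = (fun h => (1 - p h x x) / h -
    \sum_(y <- N) p h x y / h * cst 1 h)).
  apply: cvgB; first exact: cvg_exit_rate.
  rewrite -[X in _ --> X](eq_bigr _ (fun y _ => mulr1 (q x y))).
  by apply: cvg_sum_rates => y _; exact: cvg_cst.
apply/funext => h; rewrite /escape mulrBl mulr_suml; congr (_ - _).
by apply: eq_bigr => y _; rewrite mulr1.
Qed.

Lemma cvg_escape0 : 1 - p h x x @[h --> 0^'+] --> 0.
Proof.
rewrite -[X in _ --> X](mulr0 (\sum_(y <- N) q x y)).
apply: (@cvg_trans _ ((1 - p h x x) / h * h @[h --> 0^'+])).
  apply: near_eq_cvg; near=> h; have h0 : 0 < h by near: h; exact: nbhs_right_gt.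
  by rewrite divfK// gt_eqF.
apply: cvgM; first exact: cvg_exit_rate.
by apply: cvg_at_right_filter; exact: cvg_id.
Unshelve. all: by end_near. Qed.

(** With [N] empty, [transition_increment] bounds an increment over a time h by [1 - p h x x],
    uniformly in the starting time. *)
Lemma continuous_transition (z : S) : continuous (fun t : R => p `|t| x z).
Proof.
move=> t; apply/cvgrPdist_le => e e0.
have /cvgr0Pnorm_le/(_ _ e0) := cvg_escape0.
move=> [d /= d0 small].
have incr (a b : R) : 0 <= a -> a < b -> b - a < d -> `|p b x z - p a x z| <= e.
  move=> a0 ab bd; have h0 : 0 < b - a by rewrite subr_gt0.
  have /= := @transition_increment [::] x isT isT z (b - a) a (ltW h0) a0.
  rewrite big_nil subr0 subrK => /le_trans; apply.
  rewrite /escape big_nil subr0 (le_trans (ler_norm _))// small//=.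
  by rewrite sub0r normrN gtr0_norm.
exists d => //= s /= ts.
have st := le_lt_trans (ler_dist_dist t s) ts.
have [ab|ab|->] := ltgtP `|t| `|s|; last by rewrite subrr normr0 ltW.
  by rewrite distrC incr// (le_lt_trans (ler_norm _))// distrC.
by rewrite incr// (le_lt_trans (ler_norm _)).
Qed.

Hypothesis q_cont : forall y z, y \in N -> continuous (fun t : R => p `|t| y z).

(** The right derivative follows from the increment starting at [t]. The left one uses the increment
    starting at [t - h], whose differences still depend on h; this is where continuity at the states
    of [N] enters. *)
Lemma is_derive_transition (z : S) (t : R) : 0 < t ->
  is_derive t 1 (fun s : R => p `|s| x z)
    (\sum_(y <- N) q x y * (p t y z - p t x z)).
Proof.
move=> t0; pose u (y : S) (s : R) := p `|s| y z.
suff D : h^-1 * (u x (h + t) - u x t) @[h --> (0 : R)^'] -->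
    \sum_(y <- N) q x y * (p t y z - p t x z).
  have D' : h^-1 *: (u x (h *: 1 + t) - u x t) @[h --> (0 : R)^'] -->
      \sum_(y <- N) q x y * (p t y z - p t x z).
    under eq_fun => h do rewrite [h *: 1]mulr1.
    exact: D.
  apply: DeriveDef; first by apply/cvg_ex; eexists; exact: D'.
  exact/cvg_lim.
have x_cont : continuous (u x) by exact: continuous_transition.
have uE (y : S) (s : R) : 0 <= s -> u y s = p s y z by move=> s0; rewrite /u ger0_norm.
apply: (@cvg_at_right_left_dnbhs _ R^o).
  apply: (@cvg_close _ _ _ _ _
    (fun h => \sum_(y <- N) p h x y / h * cst (p t y z - p t x z) h)
    (fun h => escape N x h / h)); last exact: cvg_escape_rate.
    near=> h; have h0 : 0 < h by near: h; exact: nbhs_right_gt.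
    rewrite !uE ?addr_ge0 ?(ltW t0) ?(ltW h0)//.
    have := transition_increment N_uniq xN z (ltW h0) (ltW t0).
    rewrite -(ler_pM2r (x := h^-1)) ?invr_gt0//.
    rewrite -{1}(gtr0_norm (x := h^-1)) ?invr_gt0// -normrM mulrBl mulr_suml.
    rewrite [_ * h^-1]mulrC; under eq_bigr do rewrite mulrAC.
    exact.
  by apply: cvg_sum_rates => y _; exact: cvg_cst.
apply/cvg_at_leftNP; rewrite /comp/= oppr0.
apply: (@cvg_close _ _ _ _ _
  (fun h => \sum_(y <- N) p h x y / h * (u y (t - h) - u x (t - h)))
  (fun h => escape N x h / h)); last exact: cvg_escape_rate.
  near=> h; have h0 : 0 < h by near: h; exact: nbhs_right_gt.
  have ht : h <= t by near: h; exact: nbhs_right_le.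
  rewrite [- h + t]addrC invrN mulNr -mulrN opprB.
  have th0 : 0 <= t - h by rewrite subr_ge0.
  rewrite !uE ?(ltW t0)//.
  have := transition_increment N_uniq xN z (ltW h0) th0.
  rewrite [h + _]addrC subrK.
  rewrite -(ler_pM2r (x := h^-1)) ?invr_gt0//.
  rewrite -{1}(gtr0_norm (x := h^-1)) ?invr_gt0// -normrM mulrBl mulr_suml.
  rewrite [_ * h^-1]mulrC; under eq_bigr do rewrite mulrAC.
  under [in X in _ -> X]eq_bigr do rewrite uE//.
  exact.
under eq_bigr do rewrite -!uE ?(ltW t0)//.
apply: cvg_sum_rates => y yN.
have at0 : t - h @[h --> (0 : R)^'+] --> t.
  rewrite -[X in _ --> X]subr0; apply: cvgB; first exact: cvg_cst.
  by apply: cvg_at_right_filter; exact: cvg_id.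
by apply: cvgB; [apply: (cvg_comp _ _ at0); exact: q_cont|
  apply: (cvg_comp _ _ at0); exact: x_cont].
Unshelve. all: by end_near. Qed.

End derivative.

End backward_equation.

(** * The negative binomial distribution *)

Section pascal_law.
Context {R : realType} (alpha lambda mu : R).
Hypotheses (alpha_gt0 : 0 < alpha) (lambda_gt0 : 0 < lambda) (mu_gt0 : 0 < mu).

Let a : R := alpha / lambda.
Let a_gt0 : 0 < a. Proof. exact: divr_gt0. Qed.
Let alphaE : alpha = a * lambda. Proof. by rewrite /a divfK// gt_eqF. Qed.

Local Notation theta := (theta lambda mu).
Local Notation idle := (idle alpha lambda mu).
Local Notation idle_density := (idle_density alpha lambda mu).

(** The generalised binomial coefficient a (a + 1) ... (a + k - 1) / k! for a real shape a. *)
Fixpoint pascal_coef (k : nat) : R :=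
  if k is n.+1 then pascal_coef n * (a + n%:R) / n.+1%:R else 1.

Lemma pascal_coef_ge0 (k : nat) : 0 <= pascal_coef k.
Proof.
elim: k => //= k IH.
by rewrite divr_ge0// mulr_ge0// addr_ge0// ltW.
Qed.

Definition pascal (k : nat) (s : R) : R :=
  idle s * (pascal_coef k * (1 - theta s) ^+ k).

Lemma pascal0 (s : R) : pascal 0 s = idle s.
Proof. by rewrite /pascal/= expr0 !mulr1. Qed.

(** The ratio of consecutive masses: it eliminates level k + 2 from the forward equation and gives
    the two terms of the later [flux] a common factor. *)
Lemma pascal_rec (k : nat) (s : R) :
  k.+1%:R * pascal k.+1 s = (a + k%:R) * (1 - theta s) * pascal k s.
Proof.
have k0 : k.+1%:R != 0 :> R by rewrite pnatr_eq0.
by rewrite /pascal /= exprS; field.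
Qed.

(** Forward equation of the one-phase chain at level 0; [is_derive_pascalS] treats the other
    levels. *)
Lemma is_derive_pascal0 (s : R) : 0 <= s ->
  is_derive s 1 (pascal 0) (mu * pascal 1 s - alpha * pascal 0 s).
Proof.
move=> s0; have -> : pascal 0 = idle by apply/funext => x; exact: pascal0.
have := is_derive_idle mu alpha_gt0 lambda_gt0 s0.
rewrite -[pascal 1 s](mul1r) (pascal_rec 0) pascal0 addr0.
rewrite (_ : - _ = mu * (a * (1 - theta s) * idle s) - alpha * idle s)//.
have -> : alpha * idle s = a * lambda * idle s by congr (_ * _).
by rewrite /idle_density -/a; ring.
Qed.

(** After [pascal_rec] both sides share the factor [idle s * (1 - theta s) ^+ k * pascal_coef k];
    what remains is an identity between polynomials in [theta s]. *)
Lemma is_derive_pascalS (k : nat) (s : R) : 0 <= s ->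
  is_derive s 1 (pascal k.+1)
    ((alpha + lambda * k%:R) * pascal k s + mu * (k.+2%:R * pascal k.+2 s) -
     (alpha + lambda * k.+1%:R + mu * k.+1%:R) * pascal k.+1 s).
Proof.
move=> s0.
have di := is_derive_idle mu alpha_gt0 lambda_gt0 s0.
have dt := is_derive_theta mu lambda_gt0 s0.
have := is_deriveM di (is_deriveZ (pascal_coef k.+1)
  (is_deriveX k.+1 (is_deriveB (is_derive_cst (1 : R) s (1 : R)) dt))).
rewrite (_ : _ * _ = pascal k.+1); last first.
  by apply/funext => x; rewrite /pascal !fctE.
set D := (X in is_derive _ _ _ X -> _); set D' := (X in _ -> is_derive _ _ _ X).
suff -> : D = D' by [].
rewrite /D /D' (pascal_rec k.+1) /idle_density -/a /pascal /GRing.scale/=.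
rewrite /GRing.scale/= !fctE !exprS.
have k0 : k.+1%:R != 0 :> R by rewrite pnatr_eq0.
have -> : alpha + lambda * k%:R = lambda * (a + k%:R) by rewrite alphaE; ring.
have -> : alpha + lambda * k.+1%:R = lambda * (a + k.+1%:R) by rewrite alphaE; ring.
move: a (idle s) (theta s) ((1 - theta s) ^+ k) (pascal_coef k) => b i th e c.
by rewrite -[k.+1%:R]natr1; field; rewrite natr1.
Qed.

Lemma continuous_pascal (k : nat) (s : R) : 0 <= s ->
  {for s, continuous (pascal k)}.
Proof.
move=> s0; apply/differentiable_continuous/derivable1_diffP.
by case: k => [|k]; [case: (is_derive_pascal0 s0)|case: (is_derive_pascalS k s0)].
Qed.

Lemma pascal_ge0 (k : nat) (s : R) : 0 <= s -> 0 <= pascal k s.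
Proof.
move=> s0; rewrite mulr_ge0 ?(ltW (idle_gt0 _ _ _ _))// mulr_ge0 ?pascal_coef_ge0//.
by rewrite exprn_ge0// subr_ge0 theta_le1.
Qed.

Lemma pascal_at0 (k : nat) : pascal k 0 = (k == 0)%:R.
Proof.
by rewrite /pascal idle0 theta0 subrr expr0n mul1r; case: k => [|k]; rewrite ?mulr1 ?mulr0.
Qed.

Lemma pascal_le (k : nat) (s t : R) : 0 <= s -> s <= t ->
  pascal k s <= pascal_coef k * (1 - theta t) ^+ k.
Proof.
move=> s0 st; have t0 := le_trans s0 st.
have th1 : 0 <= 1 - theta s by rewrite subr_ge0 theta_le1.
have th2 : 1 - theta s <= 1 - theta t by rewrite lerD2l lerN2 theta_ni.
apply: (@le_trans _ _ (pascal_coef k * (1 - theta s) ^+ k)).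
  rewrite ler_piMl ?idle_le1// mulr_ge0 ?pascal_coef_ge0// exprn_ge0//.
rewrite ler_wpM2l ?pascal_coef_ge0// lerXn2r ?nnegrE//.
exact: le_trans th2.
Qed.

(** Ratio test: consecutive terms have ratio (1 + a / (k + 1)) x, which is eventually below the
    midpoint [r] of x and 1. *)
Lemma pascal_coef_tail (x e : R) : 0 <= x -> x < 1 -> 0 < e ->
  exists k, (a + k%:R) * pascal_coef k * x ^+ k <= e.
Proof.
move=> x0 x1 e0; pose f k := (a + k%:R) * pascal_coef k * x ^+ k.
have f0 k : 0 <= f k.
  by rewrite !mulr_ge0 ?pascal_coef_ge0 ?exprn_ge0// addr_ge0// ltW.
have frec k : f k.+1 = (1 + a / k.+1%:R) * x * f k.
  rewrite /f /= exprS.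
  have k0 : k.+1%:R != 0 :> R by rewrite pnatr_eq0.
  by field.
pose r := (1 + x) / 2.
have r0 : 0 <= r by rewrite /r; lra.
have r1 : r < 1 by rewrite /r; lra.
have [K HK] : exists K, forall k, (K <= k)%N -> (1 + a / k.+1%:R) * x <= r.
  (* Once k + 1 is at least [c], a / (k + 1) is at most (1 - x) / 2, the distance from x to [r]. *)
  pose c := 2 * a / (1 - x).
  have c0 : 0 <= c.
    by apply: divr_ge0; [apply: mulr_ge0 => //; exact: ltW|rewrite subr_ge0 ltW].
  exists (Num.bound c) => k Kk.
  have ck : c <= k.+1%:R.
    apply: ltW; apply: (lt_le_trans (archi_boundP c0)).
    by rewrite ler_nat (leq_trans Kk).
  have k0 : 0 < k.+1%:R :> R by rewrite ltr0n.
  have ac : a / k.+1%:R <= (1 - x) / 2.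
    rewrite ler_pdivrMr//; move: ck; rewrite /c ler_pdivrMr ?subr_gt0//; lra.
  have q0 : 0 <= a / k.+1%:R by rewrite divr_ge0// ltW.
  have : 0 <= a / k.+1%:R * (1 - x) by rewrite mulr_ge0// subr_ge0 ltW.
  rewrite /r; move: (a / k.+1%:R) q0 ac => y y0 y1; nra.
have geo n : f (K + n)%N <= r ^+ n * f K.
  elim: n => [|n IH]; first by rewrite addn0 expr0 mul1r.
  rewrite addnS frec exprS -(mulrA r).
  apply: ler_pM => //; last by apply: HK; rewrite leq_addr.
  by rewrite mulr_ge0// addr_ge0// divr_ge0// ltW.
have : (fun n => r ^+ n * f K) @ \oo --> 0.
  rewrite -[X in _ --> X](mul0r (f K)).
  apply: cvgM; last exact: cvg_cst.
  by apply: cvg_expr; rewrite ger0_norm.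
move=> /cvgr0Pnorm_le/(_ _ e0)[n _ Hn].
exists (K + n)%N; apply: (le_trans (geo n)).
by apply: (le_trans (ler_norm _)); apply: Hn => /=.
Qed.

End pascal_law.

(** * Comparison of the chains with d phases and one phase *)

Section duhamel.
Context {R : realType} (alpha lambda mu : R).
Hypotheses (alpha_gt0 : 0 < alpha) (lambda_gt0 : 0 < lambda) (mu_gt0 : 0 < mu).

Local Notation theta := (theta lambda mu).
Local Notation idle := (idle alpha lambda mu).
Local Notation idle_density := (idle_density alpha lambda mu).
Local Notation pascal := (pascal alpha lambda mu).

(** [D] stands for the number of phases, [u] for the return probability and [V k] for its sum over
    the phases from level k; only these properties of the chain enter the comparison. *)
Variables (D : R) (u : R -> R) (V : nat -> R -> R).
Hypotheses (V0E : forall s, V 0 s = D * u s) (u0 : u 0 = 1)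
  (V_at0 : forall k, V k.+1 0 = 0)
  (V_bounded : forall k s, 0 <= V k s <= D)
  (u_cont : continuous u) (V_cont : forall k, continuous (V k)).
Hypothesis u_backward : forall s : R, 0 < s ->
  is_derive s 1 u (alpha * (V 1 s - V 0 s)).
Hypothesis V_backward : forall k (s : R), 0 < s -> is_derive s 1 (V k.+1)
  ((alpha + lambda * k.+1%:R) * (V k.+2 s - V k.+1 s) +
   mu * k.+1%:R * (V k s - V k.+1 s)).

(** [I] is any antiderivative of the integrand, so that the identity can be proved without
    integrals. *)
Variables (t : R) (I : R -> R).
Hypothesis t_gt0 : 0 < t.
Hypothesis I_derive : forall s : R, 0 <= s <= t ->
  is_derive s 1 I (idle_density s * u (t - s)).

Lemma is_derive_reflect (f : R -> R) (df s : R) :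
  is_derive (t - s) 1 f df -> is_derive s 1 (fun r => f (t - r)) (- df).
Proof.
move=> fdf; have h : is_derive s 1 (fun r : R => t - r) (- 1).
  by have := is_deriveB (is_derive_cst t s (1 : R)) (is_derive_id s (1 : R)); rewrite sub0r.
by have := @is_derive1_comp _ f (fun r => t - r) s _ _ fdf h; rewrite mulrN1.
Qed.

Lemma V0_backward (s : R) : 0 < s ->
  is_derive s 1 (V 0) (D * (alpha * (V 1 s - V 0 s))).
Proof.
move=> s0; have -> : V 0 = D \*: u by apply/funext => r; exact: V0E.
by apply: is_deriveZ; have := u_backward s0; rewrite V0E.
Qed.

(* What is left at the cut-off level K after the cancellations in the pairing. *)
Let flux (K : nat) (s : R) : R :=
  mu * (K.+1%:R * pascal K.+1 s) * V K (t - s) -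
  (alpha + lambda * K%:R) * pascal K s * V K.+1 (t - s).

(** Forward equations for [pascal] and backward equations for [V] telescope up to the cut-off. At
    level 0 the equation of [V 0 = D u] carries a factor [D] that the one-phase chain lacks, which
    leaves the term in [1 - D]. *)
Lemma is_derive_pairing (K : nat) (s : R) : 0 <= s -> s < t ->
  is_derive s 1 (fun s => \sum_(k < K.+1) pascal k s * V k (t - s))
    (flux K s + (1 - D) * (idle s * (alpha * (V 1 (t - s) - V 0 (t - s))))).
Proof.
move=> s0 st; have ts : 0 < t - s by rewrite subr_gt0.
elim: K => [|K IH].
  have -> : (fun s => \sum_(k < 1) pascal k s * V k (t - s)) =
      pascal 0 * (fun s => V 0 (t - s)).
    by apply/funext => r; rewrite big_ord1.
  apply: (is_derive_ext (is_deriveM (is_derive_pascal0 mu alpha_gt0 lambda_gt0 s0)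
    (is_derive_reflect (V0_backward ts)))) => //.
  by rewrite /flux /GRing.scale/= pascal0 !mul1r; ring.
have -> : (fun s => \sum_(k < K.+2) pascal k s * V k (t - s)) =
    (fun s => \sum_(k < K.+1) pascal k s * V k (t - s)) +
    pascal K.+1 * (fun s => V K.+1 (t - s)).
  by apply/funext => r; rewrite big_ord_recr.
apply: (is_derive_ext (is_deriveD IH
  (is_deriveM (is_derive_pascalS mu alpha_gt0 lambda_gt0 K s0)
    (is_derive_reflect (V_backward K ts))))) => //.
by rewrite /flux /GRing.scale/=; ring.
Qed.

(** By [pascal_rec] the flux is [(alpha / lambda + K%:R) * pascal K s] times a bounded bracket; the
    first factor is small uniformly on [0, t] by [pascal_le] and [pascal_coef_tail]. *)
Lemma flux_small (e : R) : 0 < e ->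
  exists K, forall s : R, 0 <= s <= t -> `|flux K s| <= e.
Proof.
move=> e0; have t0 := ltW t_gt0.
have D0 : 0 <= D by have /andP[] := V_bounded 0 0; exact: le_trans.
(* A bound for the bracket; [D + 1] instead of [D] keeps it positive when [D] is 0. *)
have C0 : 0 < (lambda + mu) * (D + 1).
  by apply: mulr_gt0; [exact: addr_gt0|exact: ltr_wpDl].
have x0 : 0 <= 1 - theta t by rewrite subr_ge0 theta_le1.
have x1 : 1 - theta t < 1 by rewrite ltrBlDr ltrDl theta_gt0.
have [K HK] := pascal_coef_tail alpha_gt0 lambda_gt0 x0 x1 (divr_gt0 e0 C0).
exists K => s /andP[s0 st].
have /andP[v0 vD] := V_bounded K (t - s).
have /andP[w0 wD] := V_bounded K.+1 (t - s).
have th1 : 0 <= 1 - theta s by rewrite subr_ge0 theta_le1.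
have th2 : 1 - theta s <= 1 by rewrite lerBlDr lerDl ltW// theta_gt0.
have aE : alpha + lambda * K%:R = lambda * (alpha / lambda + K%:R).
  by rewrite mulrDr (mulrC lambda (_ / _)) divfK ?gt_eqF.
have g0 : 0 <= (alpha / lambda + K%:R) * pascal K s.
  by rewrite mulr_ge0 ?pascal_ge0// addr_ge0// divr_ge0 ?ltW.
have gle : (alpha / lambda + K%:R) * pascal K s <= e / ((lambda + mu) * (D + 1)).
  apply: le_trans HK; rewrite -mulrA ler_wpM2l ?pascal_le//.
  by rewrite addr_ge0// divr_ge0 ?ltW.
rewrite /flux pascal_rec aE.
rewrite (_ : _ - _ = (alpha / lambda + K%:R) * pascal K s *
  (mu * (1 - theta s) * V K (t - s) - lambda * V K.+1 (t - s))); last by ring.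
rewrite normrM ger0_norm// -(divfK (lt0r_neq0 C0) e).
apply: ler_pM => //.
rewrite mulrDl ler_norml; apply/andP; split.
  have a1 : lambda * V K.+1 (t - s) <= lambda * (D + 1).
    by rewrite ler_wpM2l ?(ltW lambda_gt0)//; lra.
  have a2 : 0 <= mu * (1 - theta s) * V K (t - s) by rewrite !mulr_ge0// ltW.
  have a3 : 0 <= mu * (D + 1) by rewrite mulr_ge0 ?(ltW mu_gt0)//; lra.
  lra.
have b1 : 0 <= lambda * V K.+1 (t - s) by rewrite mulr_ge0// ltW.
have b2 : mu * (1 - theta s) * V K (t - s) <= mu * (D + 1).
  rewrite -mulrA ler_wpM2l ?(ltW mu_gt0)//.
  by rewrite (le_trans (ler_piMl v0 th2))//; lra.
have b3 : 0 <= lambda * (D + 1) by rewrite mulr_ge0 ?(ltW lambda_gt0)//; lra.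
lra.
Qed.

(** The pairing is corrected by an integration by parts so that its derivative is exactly the flux.
    At s = 0 only the mass at level 0 survives and at s = t only [V 0], so [X] runs from [u t] to
    [idle t] up to the terms in [I]. The mean value theorem makes the discrepancy arbitrarily
    small. *)
Lemma duhamel_identity : idle t - u t = (D - 1) * (I t - I 0).
Proof.
have t0 := ltW t_gt0.
pose X K (s : R) := \sum_(k < K.+1) pascal k s * V k (t - s) -
  (D - 1) * (idle s * u (t - s)) - (D - 1) * I s.
have X_derive K s : 0 <= s -> s < t -> is_derive s 1 (X K) (flux K s).
  move=> s0 st; have ts : 0 < t - s by rewrite subr_gt0.
  have st' : 0 <= s <= t by rewrite s0 ltW.
  apply: (is_derive_ext (is_deriveB (is_deriveB (is_derive_pairing K s0 st)
    (is_deriveZ (D - 1) (is_deriveM (is_derive_idle mu alpha_gt0 lambda_gt0 s0)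
       (is_derive_reflect (u_backward ts)))))
    (is_deriveZ (D - 1) (I_derive st')))) => //.
  by rewrite /GRing.scale/=; ring.
have X_cont K : {within `[0, t], continuous (X K)}.
  apply: continuous_in_subspaceT => s; rewrite inE/= in_itv/= => /andP[s0 st].
  have ct (f : R -> R) : continuous f -> f (t - r) @[r --> s] --> f (t - s).
    move=> cf; apply: (@cvg_comp _ _ _ (fun r => t - r) f _ (nbhs (t - s))); last exact: cf.
    by apply: cvgB; [exact: cvg_cst|exact: cvg_id].
  apply: cvgB; first apply: cvgB.
  - apply: cvg_sum_seq => k _; apply: cvgM; last exact: ct.
    exact: continuous_pascal.
  - apply: cvgM; first exact: cvg_cst.
    apply: cvgM; last exact: ct.
    exact: continuous_idle.
  - apply: cvgM; first exact: cvg_cst.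
    apply/differentiable_continuous/derivable1_diffP.
    have st' : 0 <= s <= t by rewrite s0.
    by case: (I_derive st').
have X0 K : X K 0 = u t - (D - 1) * I 0.
  rewrite /X big_ord_recl/= !pascal0 subr0 idle0 V0E big1; last first.
    by move=> i _; rewrite pascal_at0 mul0r.
  by ring.
have Xt K : X K t = idle t - (D - 1) * I t.
  rewrite /X big_ord_recl/= pascal0 subrr V0E u0 big1; last first.
    by move=> i _; rewrite V_at0 mulr0.
  by ring.
apply/eqP; rewrite -subr_eq0 -normr_le0; apply/ler_addgt0Pl => e e0.
rewrite addr0.
have [K HK] := flux_small (divr_gt0 e0 t_gt0).
have X_oo s : s \in `]0, t[%R -> is_derive s 1 (X K) (flux K s).
  by rewrite in_itv/= => /andP[s0 st]; apply: X_derive => //; exact: ltW.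
have [c] := @MVT R (X K) (flux K) 0 t t_gt0 X_oo (X_cont K).
rewrite in_itv/= => /andP[c0 ct].
rewrite X0 Xt subr0 => XE.
have -> : idle t - u t - (D - 1) * (I t - I 0) = flux K c * t.
  by rewrite -XE; ring.
rewrite normrM (gtr0_norm t_gt0) -ler_pdivlMr// HK//.
by rewrite !ltW.
Qed.

End duhamel.

(** * The chain with d phases *)

Section star_chain.
Context {R : realType} {d : nat} (alpha lambda mu : R).
Hypotheses (alpha_gt0 : 0 < alpha) (lambda_gt0 : 0 < lambda) (mu_gt0 : 0 < mu).

Definition neighbours (x : state d) : seq (state d) :=
  if x is Some (n, j) then [:: st n.+2 j; st n j]
  else [seq st 1 j | j <- enum 'I_d].

Local Notation q := (rate alpha lambda mu).

Lemma st_neq (j : 'I_d) (n m : nat) : n != m -> st n j != st m j.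
Proof.
case: n m => [|n] [|m]//= nm; apply: contraNneq nm => -[->].
exact: eqxx.
Qed.

Lemma neighbours_uniq (x : state d) : uniq (neighbours x).
Proof.
case: x => [[n j]|]/=; last by rewrite map_inj_uniq ?enum_uniq// => i j [].
by rewrite inE andbT -/(st n.+2 j) st_neq// -addn2 -[X in _ != X]addn0 eqn_add2l.
Qed.

Lemma notin_neighbours (x : state d) : x \notin neighbours x.
Proof.
case: x => [[n j]|]/=; last by apply/negP => /mapP[].
rewrite !inE negb_or -/(st n.+2 j) -/(st n.+1 j) !st_neq//.
- by rewrite -addn1 -[X in _ != X]addn0 eqn_add2l.
- by rewrite -addn2 -addn1 eqn_add2l.
Qed.

Lemma rate_ge0 (x y : state d) : 0 <= q x y.
Proof.
case: x => [[n j]|]/=; last by case: ifP => // _; exact: ltW.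
by case: ifP => _; [|case: ifP => _ //]; rewrite ?addr_ge0 ?mulr_ge0// ltW.
Qed.

Lemma rate_out (x y : state d) : y != x -> y \notin neighbours x -> q x y = 0.
Proof.
move=> _; case: x => [[n j]|]/=.
  by rewrite !inE negb_or => /andP[/negbTE -> /negbTE ->].
move=> yN; case: existsP => // -[j /eqP yj].
by move: yN; rewrite yj map_f// mem_enum.
Qed.

Lemma rate_origin (j : 'I_d) : q (origin d) (st 1 j) = alpha.
Proof. by rewrite /= ifT//; apply/existsP; exists j. Qed.

Lemma rate_up (n : nat) (j : 'I_d) :
  q (st n.+1 j) (st n.+2 j) = alpha + lambda * n.+1%:R.
Proof. by rewrite /= eqxx. Qed.

Lemma rate_down (n : nat) (j : 'I_d) : q (st n.+1 j) (st n j) = mu * n.+1%:R.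
Proof.
rewrite /= eqxx ifN// -/(st n.+2 j) st_neq//.
by rewrite -addn2 -[X in X != _]addn0 eqn_add2l.
Qed.

Variable p : R -> state d -> state d -> R.
Hypotheses (p_trans : transition_function p) (p_rates : has_rates p q).

Let p_cont (x : state d) : continuous (fun t : R => p `|t| x (origin d)).
Proof.
exact: (continuous_transition p_trans p_rates (neighbours_uniq x)
  (notin_neighbours x) (rate_ge0 x) (@rate_out x)).
Qed.

(* Even in time, so as to be continuous on the whole line. *)
Definition return_prob (t : R) : R := p `|t| (origin d) (origin d).

(** At level 0 all [d] terms start from the origin, whence the factor [d] in [level_sum0]. *)
Definition level_sum (k : nat) (t : R) : R :=
  \sum_(j < d) p `|t| (st k j) (origin d).

Lemma level_sum0 (t : R) : level_sum 0 t = d%:R * return_prob t.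
Proof. by rewrite /level_sum /= big_const_ord iter_addr_0 mulr_natl. Qed.

Lemma return_prob0 : return_prob 0 = 1.
Proof. by case: p_trans => _ _ p0 _; rewrite /return_prob normr0 p0 eqxx. Qed.

Lemma level_sumS0 (k : nat) : level_sum k.+1 0 = 0.
Proof.
by case: p_trans => _ _ p0 _; rewrite /level_sum normr0 big1.
Qed.

Lemma return_prob_ge0_le1 (t : R) : 0 <= return_prob t <= 1.
Proof.
rewrite /return_prob transition_le1// andbT.
by case: p_trans => + _ _ _; apply.
Qed.

Lemma level_sum_bounded (k : nat) (t : R) : 0 <= level_sum k t <= d%:R.
Proof.
apply/andP; split.
  by apply: sumr_ge0 => j _; case: p_trans => + _ _ _; apply.
rewrite -[leRHS]mulr1 mulr_natl -[X in _ *+ X]card_ord -sumr_const.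
by apply: ler_sum => j _; rewrite transition_le1.
Qed.

Lemma continuous_return_prob : continuous return_prob.
Proof. exact: p_cont. Qed.

Lemma continuous_level_sum (k : nat) : continuous (level_sum k).
Proof. by move=> t; apply: cvg_sum_seq => j _; exact: p_cont. Qed.

Let p_derive (x : state d) (t : R) : 0 < t ->
  is_derive t 1 (fun s : R => p `|s| x (origin d))
   (\sum_(y <- neighbours x) q x y * (p t y (origin d) - p t x (origin d))).
Proof.
apply: (is_derive_transition p_trans p_rates (neighbours_uniq x)
  (notin_neighbours x) (rate_ge0 x) (@rate_out x)).
by move=> y z _; exact: (continuous_transition p_trans p_rates (neighbours_uniq y)
  (notin_neighbours y) (rate_ge0 y) (@rate_out y)).
Qed.

Lemma is_derive_return_prob (t : R) : 0 < t ->
  is_derive t 1 return_prob (alpha * (level_sum 1 t - level_sum 0 t)).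
Proof.
move=> t0; apply: (is_derive_ext (@p_derive (origin d) t t0)) => //.
rewrite /= big_map big_enum/= /level_sum -sumrB mulr_sumr gtr0_norm//.
by apply: eq_bigr => j _; have /= -> := rate_origin j.
Qed.

(** Away from the origin the phase is kept and the rates do not depend on it, so the sums over the
    phases form a closed system. *)
Lemma is_derive_level_sum (k : nat) (t : R) : 0 < t ->
  is_derive t 1 (level_sum k.+1)
    ((alpha + lambda * k.+1%:R) * (level_sum k.+2 t - level_sum k.+1 t) +
     mu * k.+1%:R * (level_sum k t - level_sum k.+1 t)).
Proof.
move=> t0; have := @is_derive_sum _ _ _ d (fun j s => p `|s| (st k.+1 j) (origin d))
  t 1 _ (fun j => @p_derive (st k.+1 j) t t0).
move/is_derive_ext; apply.
  by move=> s; rewrite fct_sumE.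
rewrite /level_sum gtr0_norm// -!sumrB !mulr_sumr -big_split/=.
apply: eq_bigr => j _; rewrite !big_cons big_nil addr0.
by have /= -> := rate_up k j; have /= -> := rate_down k j.
Qed.

End star_chain.

(** * Renewal equations *)

Section convolution.
Context {R : realType}.
Local Notation mu := (@lebesgue_measure R).

Definition conv (k g : R -> R) (t : R) : R :=
  \int[mu]_(s in `[0, t]) (k s * g (t - s)).

Definition bounded_measurable (g : R -> R) : Prop :=
  measurable_fun [set: R] g /\ exists M, forall x, `|g x| <= M.

Lemma bounded_measurable_lin (c : R) (g h : R -> R) :
  bounded_measurable g -> bounded_measurable h ->
  bounded_measurable (fun x => g x + c * h x).
Proof.
move=> [mg [M gM]] [mh [N hN]]; split.
  by apply: measurable_funD => //; apply: measurable_funM.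
exists (M + `|c| * N) => x; rewrite (le_trans (ler_normD _ _))// lerD//.
by rewrite normrM ler_wpM2l.
Qed.

Lemma bounded_measurable_cst (c : R) : bounded_measurable (cst c).
Proof. by split; [exact: measurable_cst|exists `|c|]. Qed.

Variables (k : R -> R) (C : R).
Hypotheses (k_cont : continuous k) (k_ge0 : forall s, 0 <= k s)
  (k_le : forall s, k s <= C).

Lemma integrable_conv (g : R -> R) (t : R) (a b : R) : bounded_measurable g ->
  mu.-integrable `[a, b] (EFin \o (fun s => k s * g (t - s))).
Proof.
move=> [mg [M gM]]; apply: measurable_bounded_integrable => //.
- by rewrite /= lebesgue_measure_itv/=; case: ifP => // _; rewrite -EFinB ltry.
- apply: measurable_funTS; apply: measurable_funM.
    exact: continuous_measurable_fun.
  by apply: measurableT_comp => //; apply: measurable_funB.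
- exists (C * M); split; first by rewrite num_real.
  move=> N CN s _; rewrite /= normrM (le_trans _ (ltW CN))//.
  by rewrite ler_pM// ger0_norm.
Qed.

Lemma conv_lin (c : R) (g h : R -> R) (t : R) :
  bounded_measurable g -> bounded_measurable h ->
  conv k (fun x => g x + c * h x) t = conv k g t + c * conv k h t.
Proof.
move=> bg bh; have ig := integrable_conv t 0 t bg; have ih := integrable_conv t 0 t bh.
rewrite /conv -RintegralZl// -RintegralD//; last first.
  have := integrable_conv t 0 t (bounded_measurable_lin c (bounded_measurable_cst 0) bh).
  by congr (_.-integrable _ _); apply/funext => s /=; congr EFin; ring.
by apply: eq_Rintegral => s _; ring.
Qed.

Lemma Rintegral_expR (L t : R) : 0 < L -> 0 <= t ->
  \int[mu]_(s in `[0, t]) expR (L * (t - s)) = (expR (L * t) - 1) / L.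
Proof.
move=> L0; rewrite le_eqVlt => /predU1P[<-|t0].
  by rewrite set_itv1 Rintegral_set1 mulr0 expR0 subrr mul0r.
pose F (s : R) := - L^-1 * expR (L * (t - s)).
have dF (s : R) : is_derive s 1 F (expR (L * (t - s))).
  have h : is_derive s 1 (fun r : R => t - r) (- 1).
    have := is_deriveB (is_derive_cst t s (1 : R)) (is_derive_id s (1 : R)).
    by rewrite sub0r.
  have := is_deriveZ (- L^-1)
    (@is_derive1_comp _ (fun r => expR (L * r)) (fun r => t - r) s _ _
      (is_derive_expRl L (t - s)) h).
  move/is_derive_ext; apply => //.
  by rewrite /GRing.scale/= mulrN1 mulrN mulNr opprK mulKf// gt_eqF.
have cF : continuous F.
  by move=> s; apply/differentiable_continuous/derivable1_diffP; case: (dF s).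
rewrite /Rintegral (@continuous_FTC2 _ _ F)//.
- by rewrite /F -EFinB/= subrr mulr0 expR0 subr0; field; rewrite gt_eqF.
- apply: continuous_subspaceT => s.
  apply: (@continuous_comp _ _ _ (fun s => L * (t - s)) expR); last exact: continuous_expR.
  by apply: cvgM; [exact: cvg_cst|apply: cvgB; [exact: cvg_cst|exact: cvg_id]].
- split.
  + by move=> s _; case: (dF s).
  + by apply: cvg_at_right_filter; exact: cF.
  + by apply: cvg_at_left_filter; exact: cF.
- by move=> s _; rewrite derive1E; case: (dF s).
Qed.

(** In the norm weighted by exp(- L s), convolution with a kernel bounded by [C] has norm at most C
    / L. *)
Lemma conv_bound (A L : R) (g : R -> R) (t : R) : 0 < L -> 0 <= t ->
  bounded_measurable g -> (forall s, 0 <= s -> `|g s| <= A * expR (L * s)) ->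
  `|conv k g t| <= C / L * (A * expR (L * t)).
Proof.
move=> L0 t0 bg gA; have A0 : 0 <= A.
  by have := gA 0 (lexx _); rewrite mulr0 expR0 mulr1; exact: le_trans.
have C0 : 0 <= C := le_trans (k_ge0 0) (k_le 0).
have be : mu.-integrable `[0, t] (EFin \o (fun s => expR (L * (t - s)))).
  apply: continuous_compact_integrable; first exact: segment_compact.
  apply: continuous_subspaceT => s.
  apply: (@continuous_comp _ _ _ (fun s => L * (t - s)) expR); last exact: continuous_expR.
  by apply: cvgM; [exact: cvg_cst|apply: cvgB; [exact: cvg_cst|exact: cvg_id]].
apply: (le_trans (le_normr_Rintegral _ _)) => //; first exact: integrable_conv.
apply: (@le_trans _ _ (\int[mu]_(s in `[0, t]) (C * A * expR (L * (t - s))))).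
  apply: le_Rintegral => //.
  - by have := integrable_abse (integrable_conv t 0 t bg).
  - rewrite (_ : EFin \o _ = (fun s => (C * A)%:E *
        (EFin \o (fun s => expR (L * (t - s)))) s)%E); last first.
      by apply/funext => s /=; rewrite EFinM.
    exact: integrableZl.
  - move=> s /=; rewrite in_itv/= => /andP[s0 st].
    rewrite normrM ger0_norm// -mulrA ler_pM//.
    by rewrite gA// subr_ge0.
rewrite RintegralZl// Rintegral_expR//.
rewrite -subr_ge0 (_ : _ - _ = C * A / L); last by field; rewrite gt_eqF.
by rewrite divr_ge0 ?mulr_ge0// ltW.
Qed.

(** The error [E n] of the n-th partial sum is multiplied by [1 - D] and convolved with [k] at each
    step; for large L this contracts the weighted norm, whatever the size of [D]. *)
Lemma renewal_series (D : R) (H : R -> R) (G : nat -> R -> R) :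
  1 <= D -> bounded_measurable H -> (forall j, bounded_measurable (G j)) ->
  (forall s, 0 <= s -> `|H s| <= 1) ->
  (forall j s, 0 <= s -> G j.+1 s = conv k (G j) s) ->
  (forall s, 0 <= s -> H s = D * G 1 s - (D - 1) * conv k H s) ->
  forall t, 0 <= t ->
  D * \sum_(1 <= j < n.+1) (1 - D) ^+ j.-1 * G j t @[n --> \oo] --> H t.
Proof.
move=> D1 bH bG H1 Grec Hren t t0.
pose E n s := H s - D * \sum_(1 <= j < n.+1) (1 - D) ^+ j.-1 * G j s.
have E0 s : E 0 s = H s by rewrite /E big_geq// mulr0 subr0.
have ES n : E n.+1 = fun s => E n s + (- (D * (1 - D) ^+ n)) * G n.+1 s.
  by apply/funext => s; rewrite /E big_nat_recr//=; ring.
have bE n : bounded_measurable (E n).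
  elim: n => [|n IH]; last by rewrite ES; exact: bounded_measurable_lin.
  by rewrite (_ : E 0 = H)//; apply/funext.
(* The renewal equation is the base case; afterwards [conv k] turns the term in [G n.+1] into the
   one in [G n.+2]. *)
have Erec n s : 0 <= s -> E n.+1 s = (1 - D) * conv k (E n) s.
  move=> s0; elim: n => [|n IH].
    rewrite ES E0 Hren// expr0 mulr1 (_ : E 0 = H); last exact/funext.
    by ring.
  by rewrite ES IH [in RHS]ES conv_lin// Grec// exprS; ring.
have C0 : 0 <= C := le_trans (k_ge0 0) (k_le 0).
(* Makes the contraction factor (D - 1) C / L at most 1/2; the added 1 keeps [L] positive when [D]
   is 1. *)
pose L := 2 * ((D - 1) * C) + 1.
have DC0 : 0 <= (D - 1) * C by rewrite mulr_ge0// subr_ge0.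
have L0 : 0 < L by rewrite ltr_wpDl// mulr_ge0.
have bound n s : 0 <= s -> `|E n s| <= 2^-1 ^+ n * expR (L * s).
  elim: n s => [|n IH] s s0.
    rewrite E0 expr0 mul1r (le_trans (H1 _ s0))// -expR0 ler_expR.
    by rewrite mulr_ge0// ltW.
  rewrite Erec// normrM distrC (ger0_norm (x := D - 1)) ?subr_ge0//.
  apply: (@le_trans _ _ ((D - 1) * (C / L * (2^-1 ^+ n * expR (L * s))))).
    by rewrite ler_wpM2l ?subr_ge0// conv_bound.
  have half : (D - 1) * C / L <= 2^-1 by rewrite ler_pdivrMr// /L; lra.
  rewrite exprS -(mulrA 2^-1) !mulrA -(mulrA ((D - 1) * C / L)) -(mulrA 2^-1).
  by rewrite ler_wpM2r// mulr_ge0 ?exprn_ge0 ?expR_ge0.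
have Ecvg : E n t @[n --> \oo] --> 0.
  apply/cvgr0Pnorm_le => e e0.
  have : (fun n => 2^-1 ^+ n * expR (L * t)) @ \oo --> 0.
    rewrite -[X in _ --> X](mul0r (expR (L * t))).
    apply: cvgM; last exact: cvg_cst.
    by apply: cvg_expr; rewrite ger0_norm// invf_lt1// ltr1n.
  move=> /cvgr0Pnorm_le/(_ _ e0); apply: filterS => n.
  by apply: le_trans; rewrite (le_trans (bound n t t0))// ler_norm.
rewrite (_ : (fun n => _) = (fun n => H t - E n t)); last first.
  by apply/funext => n; rewrite /E subKr.
by rewrite -[X in _ --> X]subr0; apply: cvgB => //; exact: cvg_cst.
Qed.

End convolution.

(** * The renewal equation for the return probability *)

Section primitive.
Context {R : realType} (h : R -> R).
Local Notation mu := (@lebesgue_measure R).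
Hypothesis h_cont : continuous h.

(** The base point -1 makes 0 an interior point, so the derivative at 0 is two-sided. *)
Definition primitive (s : R) : R := \int[mu]_(r in `[- 1, s]) h r.

Let h_int (a b : R) : mu.-integrable `[a, b] (EFin \o h).
Proof.
apply: continuous_compact_integrable; first exact: segment_compact.
exact: continuous_subspaceT.
Qed.

Lemma is_derive_primitive (s : R) : -1 < s -> is_derive s 1 primitive (h s).
Proof.
move=> s1; have ss : s < s + 1 by rewrite ltrDl.
have [dI <-] := continuous_FTC1_closed ss (h_int (-1) (s + 1)) s1 (@h_cont s).
by rewrite derive1E; exact: derivableP.
Qed.

Lemma primitive_increment (t : R) : 0 <= t ->
  primitive t - primitive 0 = \int[mu]_(s in `[0, t]) h s.
Proof.
move=> t0; rewrite /primitive (@Rintegral_itvB _ h (BLeft (-1)) (BRight t) 0)//.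
- rewrite -Rintegral_itv_obnd_cbnd//; apply: integrableS (h_int 0 t) => //.
  exact: subset_itv_oc_cc.
- by rewrite bnd_simp lerN10.
Qed.

End primitive.

Section star_renewal.
Context {R : realType} {d : nat} (alpha lambda mu : R).
Hypotheses (alpha_gt0 : 0 < alpha) (lambda_gt0 : 0 < lambda) (mu_gt0 : 0 < mu).
Variable p : R -> state d -> state d -> R.
Hypotheses (p_trans : transition_function p)
  (p_rates : has_rates p (rate alpha lambda mu)).

Local Notation leb := (@lebesgue_measure R).

Definition idle_kernel (s : R) : R := idle_density alpha lambda mu `|s|.

Lemma idle_kernel_ge0 (s : R) : 0 <= idle_kernel s.
Proof. by apply: idle_density_ge0. Qed.

Lemma idle_kernel_le (s : R) : idle_kernel s <= alpha.
Proof. by apply: idle_density_le. Qed.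

Lemma continuous_idle_kernel : continuous idle_kernel.
Proof. exact: continuous_idle_density_norm. Qed.

Lemma Rintegral_idle_kernel (t : R) : 0 <= t ->
  \int[leb]_(s in `[0, t]) idle_kernel s = 1 - idle alpha lambda mu t.
Proof.
move=> t0; have := t0; rewrite le_eqVlt => /predU1P[<-|t_gt0].
  by rewrite set_itv1 Rintegral_set1 idle0 subrr.
rewrite -primitive_increment//; last exact: continuous_idle_kernel.
pose X (s : R) := primitive idle_kernel s + idle alpha lambda mu s.
have dX (s : R) : 0 <= s -> is_derive s 1 X 0.
  move=> s0; have s1 : -1 < s by rewrite (lt_le_trans _ s0).
  apply: (is_derive_ext (is_deriveD (is_derive_primitive continuous_idle_kernel s1)
    (is_derive_idle mu alpha_gt0 lambda_gt0 s0))) => //.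
  by rewrite /idle_kernel ger0_norm// subrr.
have X_oo s : s \in `]0, t[%R -> is_derive s 1 X 0.
  by rewrite in_itv/= => /andP[s0 _]; apply: dX; exact: ltW.
have X_cont : {within `[0, t], continuous X}.
  apply: continuous_in_subspaceT => s; rewrite inE/= in_itv/= => /andP[s0 _].
  by apply/differentiable_continuous/derivable1_diffP; case: (dX _ s0).
have [c _] := @MVT R X (fun=> 0) 0 t t_gt0 X_oo X_cont.
by rewrite /X mul0r idle0; lra.
Qed.

Lemma star_renewal (t : R) : 0 <= t ->
  1 - return_prob p t = d%:R * (1 - idle alpha lambda mu t) -
    (d%:R - 1) * conv idle_kernel (fun s => 1 - return_prob p s) t.
Proof.
rewrite le_eqVlt => /predU1P[<-|t_gt0].
  by rewrite /conv set_itv1 Rintegral_set1 (return_prob0 p_trans) idle0; ring.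
have t0 := ltW t_gt0.
pose h (s : R) := idle_kernel s * (1 - return_prob p (t - s)).
have h_cont : continuous h.
  move=> s; apply: cvgM; first exact: continuous_idle_kernel.
  apply: cvgB; first exact: cvg_cst.
  apply: (@cvg_comp _ _ _ (fun r => t - r) (return_prob p) _ (nbhs (t - s))).
    by apply: cvgB; [exact: cvg_cst|exact: cvg_id].
  exact: (continuous_return_prob alpha_gt0 lambda_gt0 mu_gt0 p_trans p_rates).
(* The derivative of [- idle] is the density; subtracting the density times [1 - return_prob] leaves
   the integrand required by [duhamel_identity]. *)
pose I (s : R) := - idle alpha lambda mu s - primitive h s.
have I_derive (s : R) : 0 <= s <= t ->
    is_derive s 1 I (idle_density alpha lambda mu s * return_prob p (t - s)).
  move=> /andP[s0 st]; have s1 : -1 < s by rewrite (lt_le_trans _ s0).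
  apply: (is_derive_ext (is_deriveB
    (is_deriveN (is_derive_idle mu alpha_gt0 lambda_gt0 s0))
    (is_derive_primitive h_cont s1))) => //.
  by rewrite /h /idle_kernel (ger0_norm s0); ring.
have := @duhamel_identity R alpha lambda mu alpha_gt0 lambda_gt0 mu_gt0 d%:R
  (return_prob p) (level_sum p) (level_sum0 p) (return_prob0 p_trans)
  (level_sumS0 p_trans) (level_sum_bounded p_trans)
  (continuous_return_prob alpha_gt0 lambda_gt0 mu_gt0 p_trans p_rates)
  (continuous_level_sum alpha_gt0 lambda_gt0 mu_gt0 p_trans p_rates)
  (is_derive_return_prob alpha_gt0 lambda_gt0 mu_gt0 p_trans p_rates)
  (is_derive_level_sum alpha_gt0 lambda_gt0 mu_gt0 p_trans p_rates) t I t_gt0 I_derive.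
rewrite /I idle0 /conv -/h -(primitive_increment h_cont t0).
move: (primitive h t) (primitive h 0) => a b e.
rewrite -[return_prob p t](subKr (idle alpha lambda mu t)) e; ring.
Qed.

End star_renewal.

(** * Sums of independent variables *)

Section restricted_law.
Context {d d'} {U : measurableType d} {T : measurableType d'} {R : realType}.
Variables (Q : probability U R) (f : U -> T) (E : set U).

(** The law of [f] on the event [E], left unnormalised so that events of probability 0 need no
    special treatment. The measurability proofs are arguments so that measure instances can be
    attached. *)
Definition restricted_law (mf : measurable_fun [set: U] f) (mE : measurable E) :
  set T -> \bar R := fun A => Q (f @^-1` A `&` E).

Hypotheses (mf : measurable_fun [set: U] f) (mE : measurable E).

Let law := restricted_law mf mE.

Let law0 : law set0 = 0%E.
Proof. by rewrite /law /restricted_law preimage_set0 set0I measure0. Qed.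

Let law_ge0 A : (0 <= law A)%E.
Proof. exact: measure_ge0. Qed.

Let law_sigma_additive : semi_sigma_additive law.
Proof. exact: (@measure_semi_sigma_additive _ _ _ (pushforward (mrestr Q mE) f)). Qed.

HB.instance Definition _ := isMeasure.Build _ _ _ (restricted_law mf mE)
  law0 law_ge0 law_sigma_additive.

Let law_fin : fin_num_fun law.
Proof.
move=> A mA; rewrite /law /restricted_law fin_num_measure//.
apply: measurableI => //; rewrite -[X in measurable X]setTI; exact: mf.
Qed.

HB.instance Definition _ := Measure_isFinite.Build _ _ _ (restricted_law mf mE)
  law_fin.

End restricted_law.

Section pair_law.
Context {d d1 d2} {U : measurableType d} {T1 : measurableType d1}
  {T2 : measurableType d2} {R : realType} (Q : probability U R).
Variables (f : U -> T1) (g : U -> T2) (E : set U).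
Hypotheses (mf : measurable_fun [set: U] f) (mg : measurable_fun [set: U] g)
  (mE : measurable E).
Hypothesis fgE : forall A B, measurable A -> measurable B ->
  Q (f @^-1` A `&` g @^-1` B `&` E) = (Q (f @^-1` A `&` E) * Q (g @^-1` B))%E.

Let m1 := restricted_law Q mf mE.
Let m2 := restricted_law Q mg measurableT.

Let m12_rect A B : measurable A -> measurable B ->
  restricted_law Q (measurable_fun_pair mf mg) mE (A `*` B) = (m1 A * m2 B)%E.
Proof. by move=> mA mB; rewrite /m2 /restricted_law setIT -fgE. Qed.

(** By [fgE] the law of the pair on [E] agrees with a product measure on rectangles, hence
    everywhere. [pair_law2] integrates in the other order. *)
Lemma pair_law1 (X : set (T1 * T2)) : measurable X ->
  Q ([set w | X (f w, g w)] `&` E) =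
    (\int[m1]_x Q (g @^-1` xsection X x))%E.
Proof.
move=> mX; apply: (etrans (esym (product_measure_unique m12_rect mX))).
by apply: eq_integral => x _; rewrite /= /m2 /restricted_law setIT.
Qed.

Lemma pair_law2 (X : set (T1 * T2)) : measurable X ->
  Q ([set w | X (f w, g w)] `&` E) =
    (\int[m2]_y Q (f @^-1` ysection X y `&` E))%E.
Proof.
move=> mX; apply: (etrans (esym (product_measure_unique m12_rect mX))).
rewrite (@product_measure_unique _ _ _ _ _ m1 m2 (m1 \x^ m2)%E)//.
by move=> A B mA mB; exact: product_measure2E.
Qed.

End pair_law.

Section sums.
Context {d} {U : measurableType d} {R : realType} (Q : probability U R).
Variable Y : nat -> {RV Q >-> R}.
Hypothesis Y_indep : mutually_independent Y.

Definition partial_sum (j : nat) (w : U) : R := \sum_(i < j) Y i w.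

Lemma measurable_partial_sum (j : nat) : measurable_fun [set: U] (partial_sum j).
Proof. by apply: measurable_sum. Qed.

Let mpre (f : U -> R) (A : set R) : measurable_fun [set: U] f -> measurable A ->
  measurable (f @^-1` A).
Proof. by move=> mf mA; rewrite -[X in measurable X]setTI; exact: mf. Qed.

Let mcyl (I : seq nat) (B : nat -> set R) : (forall i, measurable (B i)) ->
  measurable (\bigcap_(i in [set` I]) (Y i @^-1` B i)).
Proof. by move=> mB; apply: bigcap_measurableType => i _; exact: mpre. Qed.

(* The independence of the remaining variables is carried along, because the
   inductive step adds [Y j] to the conditioning event. *)
Lemma partial_sum_indep (j : nat) (A : set R) (I : seq nat) (B : nat -> set R) :
  measurable A -> uniq I -> (forall i, i \in I -> (j <= i)%N) ->
  (forall i, measurable (B i)) ->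
  Q (partial_sum j @^-1` A `&` \bigcap_(i in [set` I]) (Y i @^-1` B i)) =
  (Q (partial_sum j @^-1` A) * Q (\bigcap_(i in [set` I]) (Y i @^-1` B i)))%E.
Proof.
elim: j A I B => [|j IH] A I B mA uI jI mB.
  have [A0|A0] := pselect (A 0).
    have -> : partial_sum 0 @^-1` A = setT.
      by apply/seteqP; split=> // w _; rewrite /= /partial_sum big_ord0.
    by rewrite setTI probability_setT mul1e.
  have -> : partial_sum 0 @^-1` A = set0.
    by apply/seteqP; split=> // w; rewrite /= /partial_sum big_ord0.
  by rewrite set0I measure0 mul0e.
pose X : set (R * R) := [set z | A (z.1 + z.2)].
have mX : measurable X.
  rewrite /X -[X in measurable X]setTI.
  have : measurable_fun [set: R * R] (fun z : R * R => z.1 + z.2).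
    by apply: measurable_funD.
  exact.
have SE : partial_sum j.+1 @^-1` A = [set w | X (partial_sum j w, Y j w)].
  by apply/seteqP; split=> w; rewrite /X /= /partial_sum big_ord_recr.
have jnI : j \notin I by apply/negP => /jI; rewrite ltnn.
(* Independence of the j-th partial sum and [Y j] on a cylinder, used for [J = I] and for the empty
   list. *)
have ind (J : seq nat) : {subset J <= I} -> uniq J -> forall A' B' : set R,
    measurable A' -> measurable B' ->
    Q (partial_sum j @^-1` A' `&` Y j @^-1` B' `&`
       \bigcap_(i in [set` J]) (Y i @^-1` B i)) =
    (Q (partial_sum j @^-1` A' `&` \bigcap_(i in [set` J]) (Y i @^-1` B i)) *
     Q (Y j @^-1` B'))%E.
  move=> JI uJ A' B' mA' mB'.
  have jnJ : j \notin J by apply: contra jnI; exact: JI.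
  pose B1 i := if i == j then B' else B i.
  have mB1 i : measurable (B1 i) by rewrite /B1; case: ifP.
  have capE : \bigcap_(i in [set` j :: J]) (Y i @^-1` B1 i) =
      Y j @^-1` B' `&` \bigcap_(i in [set` J]) (Y i @^-1` B i).
    apply/seteqP; split=> [w H|w [H1 H2] i /=].
      split=> [|i /= iJ]; first by have := H j (mem_head _ _); rewrite /B1 eqxx.
      have := H i; rewrite /B1 ifN; first by apply; rewrite /= in_cons iJ orbT.
      by apply: contraNneq jnJ => <-.
    by rewrite in_cons /B1; case: eqP => [-> //|_ /= iJ]; exact: H2.
  have ju : uniq (j :: J) by rewrite /= jnJ.
  have jle (K : seq nat) : {subset K <= j :: I} -> forall i, i \in K -> (j <= i)%N.
    by move=> KI i /KI; rewrite in_cons => /predU1P[->//|/jI/ltnW].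
  have subJ : {subset J <= j :: I} by move=> i /JI iI; rewrite in_cons iI orbT.
  have cylE : Q (\bigcap_(i in [set` j :: J]) (Y i @^-1` B1 i)) =
      (Q (Y j @^-1` B') * Q (\bigcap_(i in [set` J]) (Y i @^-1` B i)))%E.
    rewrite (Y_indep ju mB1) (Y_indep uJ mB) big_cons {1}/B1 eqxx.
    congr (_ * _)%E; apply: eq_big_seq => i iJ; rewrite /B1 ifN//.
    by apply: contraNneq jnJ => <-.
  rewrite -setIA -capE (IH _ _ _ mA' ju _ mB1); last first.
    by apply: jle => i; rewrite in_cons => /predU1P[->|/subJ//]; rewrite mem_head.
  by rewrite cylE (IH _ _ _ mA' uJ (jle _ subJ) mB) muleA muleAC.
have jI' i : i \in I -> (j <= i)%N by move=> /jI/ltnW.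
have mYj : measurable_fun [set: U] (Y j) by [].
have indT A' B' : measurable A' -> measurable B' ->
    Q (partial_sum j @^-1` A' `&` Y j @^-1` B' `&` [set: U]) =
    (Q (partial_sum j @^-1` A' `&` [set: U]) * Q (Y j @^-1` B'))%E.
  move=> mA' mB'; have sub0 : {subset [::] <= I} by [].
  have := ind [::] sub0 isT A' B' mA' mB'.
  by rewrite set_nil bigcap_set0.
(* Both sides become integrals over the law of [Y j], and the induction hypothesis factors the
   cylinder out of each section. *)
rewrite SE (pair_law2 (measurable_partial_sum j) mYj (mcyl I mB)
  (ind I (fun i h => h) uI) mX).
rewrite -[X in (Q X * _)%E]setIT
  (pair_law2 (measurable_partial_sum j) mYj measurableT indT mX).
rewrite -ge0_integralZr//.
- apply: eq_integral => y _; rewrite setIT IH//; exact: measurable_ysection.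
- exact: (measurable_fun_ysection
    (restricted_law Q (measurable_partial_sum j) measurableT)).
Qed.

End sums.

(** * Distribution functions of the partial sums as iterated convolutions *)

Section convolution_cdf.
Context {d} {U : measurableType d} {R : realType} (Q : probability U R).
Variable Y : nat -> {RV Q >-> R}.
Hypotheses (Y_indep : mutually_independent Y) (Y_ge0 : forall i w, 0 <= Y i w).
Variables (k : R -> R) (c : R).
Hypotheses (k_cont : continuous k) (k_ge0 : forall s, 0 <= k s) (c_gt0 : 0 < c).
Local Notation leb := (@lebesgue_measure R).
Hypothesis Y_cdf : forall i (s : R), 0 <= s ->
  (c%:E * cdf (Y i) s = \int[leb]_(r in `[0%R, s]) (k r)%:E)%E.

Let measurable_sum_le (j : nat) (s : R) :
  measurable [set w | partial_sum Y j w <= s].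
Proof.
rewrite -[X in measurable X]setTI -preimage_itvNyc.
exact: measurable_partial_sum.
Qed.

Lemma Fsum_prob (j : nat) (s : R) :
  (Fsum Y j s)%:E = Q [set w | partial_sum Y j w <= s].
Proof. by rewrite /Fsum fineK// fin_num_measure//; exact: measurable_sum_le. Qed.

Lemma Fsum_ge0_le1 (j : nat) (s : R) : 0 <= Fsum Y j s <= 1.
Proof. by rewrite -!lee_fin Fsum_prob measure_ge0/= probability_le1. Qed.

Lemma Fsum_nd (j : nat) : {homo Fsum Y j : s t / s <= t}.
Proof.
move=> s t st; rewrite -lee_fin !Fsum_prob le_measure// ?inE//.
by move=> w /= /le_trans; apply.
Qed.

Lemma bounded_measurable_Fsum (j : nat) : bounded_measurable (Fsum Y j).
Proof.
split; first by apply: nondecreasing_measurable => // s t; exact: Fsum_nd.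
exists 1 => s; have /andP[F0 F1] := Fsum_ge0_le1 j s.
by rewrite ger0_norm.
Qed.

Lemma partial_sum_ge0 (j : nat) (w : U) : 0 <= partial_sum Y j w.
Proof. exact: sumr_ge0. Qed.

Lemma cdf_lt0 (i : nat) (s : R) : s < 0 -> cdf (Y i) s = 0%E.
Proof.
move=> s0; rewrite /cdf /distribution /pushforward.
rewrite (_ : _ @^-1` _ = set0) ?measure0//.
apply/seteqP; split=> // w /=; rewrite in_itv/= => /le_lt_trans/(_ s0).
by rewrite ltNge Y_ge0.
Qed.

(** The j-th partial sum and [Y j] are independent; integrating over [Y j] first leaves its
    distribution function at the remaining time. *)
Lemma Fsum_recl (j : nat) (t : R) :
  (Fsum Y j.+1 t)%:E = (\int[Q]_w cdf (Y j) (t - partial_sum Y j w))%E.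
Proof.
pose X : set (R * R) := [set z | z.1 + z.2 <= t].
have mX : measurable X.
  rewrite /X -[X in measurable X]setTI -preimage_itvNyc.
  by apply: measurable_funD.
have mYj : measurable_fun [set: U] (Y j) by [].
have ind A B : measurable A -> measurable B ->
    Q (partial_sum Y j @^-1` A `&` Y j @^-1` B `&` [set: U]) =
    (Q (partial_sum Y j @^-1` A `&` [set: U]) * Q (Y j @^-1` B))%E.
  move=> mA mB; rewrite !setIT.
  have := @partial_sum_indep _ _ _ _ _ Y_indep j A [:: j] (fun=> B) mA isT.
  rewrite set_cons1 bigcap_set1; apply => //.
  by move=> i; rewrite inE => /eqP ->.
have := pair_law1 (measurable_partial_sum Y j) mYj measurableT ind mX.
rewrite setIT Fsum_prob => H; rewrite (_ : [set w | _] =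
    [set w | X (partial_sum Y j w, Y j w)]); last first.
  by apply/seteqP; split=> w; rewrite /X /= /partial_sum big_ord_recr.
rewrite H.
have mS : measurable_fun [set: U] (partial_sum Y j) := measurable_partial_sum Y j.
rewrite (eq_measure_integral (pushforward Q (partial_sum Y j))); last first.
  by move=> A mA _; rewrite /= /restricted_law setIT.
rewrite ge0_integral_pushforward//; last first.
  under eq_fun do rewrite -[Y j @^-1` _]setIT.
  exact: (measurable_fun_xsection (restricted_law Q mYj measurableT)).
rewrite preimage_setT; apply: eq_integral => w _ /=.
rewrite /cdf /distribution /pushforward; congr (Q _).
apply/seteqP; split=> u /=; rewrite in_itv/= /xsection/= inE /X/= -lerBrDl//.
Qed.

(** [Y_cdf] writes the distribution function in [Fsum_recl] as an integral of [k]; exchanging the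
    integrals turns the inner one into [Fsum Y j (t - s)]. *)
Lemma Fsum_conv (j : nat) (t : R) : 0 <= t ->
  c * Fsum Y j.+1 t = conv k (Fsum Y j) t.
Proof.
move=> t0; pose A : set (U * R) := [set z | partial_sum Y j z.1 + z.2 <= t].
have mS : measurable_fun [set: U] (partial_sum Y j) := measurable_partial_sum Y j.
have mA : measurable A.
  rewrite /A -[X in measurable X]setTI -preimage_itvNyc.
  apply: measurable_funD => //.
  exact: measurableT_comp.
pose f (z : U * R) : \bar R :=
  (k z.2 * \1_(`[0, t]%classic : set R) z.2 * \1_A z)%:E.
have f0 z : (0 <= f z)%E by rewrite lee_fin !mulr_ge0.
have mf : measurable_fun [set: U * R] f.
  apply/measurable_EFinP; apply: measurable_funM; last exact: measurable_indic.
  apply: measurable_funM; apply: measurableT_comp => //.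
  exact: continuous_measurable_fun.
(* Nonnegativity of the partial sum makes the constraint s <= t redundant. *)
have indE (w : U) (s : R) : \1_(`[0, t]%classic : set R) s * \1_A (w, s) =
    \1_(`[0, t - partial_sum Y j w]%classic : set R) s :> R.
  have S0 := partial_sum_ge0 j w.
  rewrite !indicE -natrM mulnb; congr (nat_of_bool _)%:R.
  apply/andP/idP; rewrite !inE /A /= !in_itv/=.
    by move=> [/andP[-> _]]; rewrite lerBrDl.
  move=> /andP[s0 sS]; rewrite s0 -lerBrDl sS; split=> //.
  by rewrite (le_trans sS)// gerBl.
have inner (w : U) : (c%:E * cdf (Y j) (t - partial_sum Y j w) =
    \int[leb]_s f (w, s))%E.
  under eq_integral do rewrite /f/= -mulrA indE.
  (* If the partial sum already exceeds [t], the interval is empty and the distribution function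
     vanishes. *)
  have [tS|tS] := leP (partial_sum Y j w) t; last first.
    rewrite cdf_lt0 ?subr_lt0// mule0 integral0_eq// => s _.
    by rewrite set_itv_ge ?indic0 ?mulr0// bnd_simp -ltNge subr_lt0.
  rewrite Y_cdf ?subr_ge0// [LHS]integral_mkcond; apply: eq_integral => s _.
  by rewrite patchE indicE; case: ifPn; rewrite ?mulr1 ?mulr0.
have mcdf : measurable_fun [set: U] (fun w => cdf (Y j) (t - partial_sum Y j w)).
  apply: (@measurableT_comp _ _ _ _ _ _ (cdf (Y j)) _ (fun w => t - partial_sum Y j w)).
    exact: cdf_measurable.
  by apply: measurable_funB.
have : (c%:E * (Fsum Y j.+1 t)%:E =
    \int[leb]_(s in `[0%R, t]) (k s * Fsum Y j (t - s))%:E)%E.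
  rewrite Fsum_recl -ge0_integralZl//; last by rewrite lee_fin ltW.
  under eq_integral do rewrite inner.
  rewrite (fubini_tonelli (m1 := Q) (m2 := leb))// [RHS]integral_mkcond.
  apply: eq_integral => s _; rewrite patchE.
  have [sI|sI] := ifPn; last first.
    by rewrite integral0_eq// => w _; rewrite /f/= indicE (negbTE sI) mulr0 mul0r.
  rewrite EFinM Fsum_prob -[X in Q X]setIT -integral_indic//.
  rewrite -ge0_integralZl//; [|by apply/measurable_EFinP; exact: measurable_indic
    |by rewrite lee_fin].
  apply: eq_integral => w _; rewrite /f /= indicE sI mulr1 EFinM.
  congr (_ * _%:E)%E; rewrite !indicE; congr (nat_of_bool _)%:R.
  by apply/idP/idP; rewrite !inE /A/= lerBrDr.
by rewrite -EFinM => /(congr1 fine).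
Qed.

End convolution_cdf.

(** * Identification of the series with the return probability *)

Lemma busy_mass_cdf {R : realType} (alpha lambda mu : R) d (U : measurableType d)
    (Q : probability U R) (Y : {RV Q >-> R}) (s : R) :
  0 < alpha -> 0 < lambda -> 0 < mu -> 0 <= s ->
  cdf Y s = (FY alpha lambda mu s)%:E ->
  ((busy_mass alpha lambda mu)%:E * cdf Y s =
    \int[@lebesgue_measure R]_(r in `[0%R, s]) (idle_kernel alpha lambda mu r)%:E)%E.
Proof.
move=> a0 l0 m0 s0 ->; rewrite -EFinM FY_idle// -Rintegral_idle_kernel//.
rewrite /Rintegral fineK//; apply: integrable_fin_num => //.
apply: continuous_compact_integrable; first exact: segment_compact.
exact/continuous_subspaceT/continuous_idle_kernel.
Qed.

Theorem theorem3p1 (R : realType) (d : nat) (alpha lambda mu : R)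
    (d_gt0 : (0 < d)%N) (alpha_gt0 : 0 < alpha) (lambda_gt0 : 0 < lambda)
    (mu_gt0 : 0 < mu)
    (dT : measure_display) (T : measurableType dT) (P : probability T R)
    (X : R -> T -> state d)
    (X_ctmc : ctmc P (rate alpha lambda mu) X)
    (X_start : P (X 0 @^-1` [set origin d]) = 1%E)
    (dU : measure_display) (U : measurableType dU) (Q : probability U R)
    (Y : nat -> {RV Q >-> R})
    (Y_indep : mutually_independent Y)
    (Y_ge0 : forall i w, 0 <= Y i w)
    (Y_cdf : forall i s, 0 <= s -> cdf (Y i) s = (FY alpha lambda mu s)%:E)
    (t : R) (t_ge0 : 0 <= t) :
  if mu <= lambda then
    let S n := \sum_(1 <= j < n.+1) (1 - d%:R) ^+ j.-1 * Fsum Y j t in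
    cvgn S /\ p0 P X t = 1 - d%:R * limn S
  else
    let S n := \sum_(1 <= j < n.+1) (1 - d%:R) ^+ j.-1 *
                 (1 - ((mu - lambda) / mu) `^ (alpha / lambda)) ^+ j *
                 Fsum Y j t in
    cvgn S /\ p0 P X t = 1 - d%:R * limn S.
Proof.
have [_ _ [p [p_trans p_rates p_markov]]] := X_ctmc.
have p0E : p0 P X t = return_prob p t.
  (* A history consisting of time 0 alone; all later times are set to [t] to keep the sequence
     nondecreasing. *)
  have := p_markov 0%N (fun n => if n is 0%N then 0 else t) (fun=> origin d).
  rewrite /= bigcap_mkord big_ord1/= X_start lte01 subr0 => /(_ (lexx _)).
  rewrite /return_prob ger0_norm//; apply => //.
  by case.
pose c := busy_mass alpha lambda mu.
have c_gt0 : 0 < c by exact: busy_mass_gt0.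
pose k := idle_kernel alpha lambda mu.
have k_cont : continuous k by exact: continuous_idle_kernel.
have k_ge0 s : 0 <= k s by exact: idle_kernel_ge0.
have k_le s : k s <= alpha by exact: idle_kernel_le.
have cdfE i (s : R) : 0 <= s -> (c%:E * cdf (Y i) s =
    \int[@lebesgue_measure R]_(r in `[0%R, s]) (k r)%:E)%E.
  by move=> s0; apply: busy_mass_cdf => //; exact: Y_cdf.
(* The powers of [c] absorb the normalisation of the law of Y, so both cases of the theorem share
   one series. *)
pose G j s := c ^+ j * Fsum Y j s.
pose H s := 1 - return_prob p s.
have bG j : bounded_measurable (G j).
  have := bounded_measurable_lin (c ^+ j) (bounded_measurable_cst 0)
    (bounded_measurable_Fsum Y j).
  by congr bounded_measurable; apply/funext => s; rewrite add0r.
have bH : bounded_measurable H.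
  split.
    apply: measurable_funB => //; apply: continuous_measurable_fun.
    exact: (continuous_return_prob alpha_gt0 lambda_gt0 mu_gt0 p_trans p_rates).
  exists 1 => s; have /andP[r0 r1] := return_prob_ge0_le1 p_trans s.
  by rewrite ger0_norm ?subr_ge0// /H gerBl.
have Grec j s : 0 <= s -> G j.+1 s = conv k (G j) s.
  move=> s0; rewrite /G exprSr -mulrA (Fsum_conv Y_indep Y_ge0 k_cont k_ge0 c_gt0 cdfE)//.
  (* Homogeneity of the convolution, obtained from linearity with a zero first summand. *)
  have := conv_lin k_cont k_ge0 k_le (c ^+ j) s (bounded_measurable_cst 0)
    (bounded_measurable_Fsum Y j).
  rewrite (_ : conv k (cst 0) s = 0) ?add0r; last first.
    by rewrite /conv; under eq_Rintegral do rewrite mulr0; rewrite Rintegral_cst// mul0r.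
  by move=> <-; congr (conv k _ s); apply/funext => r; rewrite add0r.
have G1 s : 0 <= s -> G 1 s = 1 - idle alpha lambda mu s.
  move=> s0; rewrite /G expr1 -(FY_idle alpha_gt0 lambda_gt0 mu_gt0 s0) -/c.
  congr (_ * _); apply: EFin_inj; rewrite -(Y_cdf 0%N)// Fsum_prob.
  congr (Q _); apply/seteqP; split=> w /=; rewrite in_itv/= /partial_sum big_ord1//.
have H1 s : 0 <= s -> `|H s| <= 1.
  move=> s0; have /andP[r0 r1] := return_prob_ge0_le1 p_trans s.
  by rewrite ger0_norm ?subr_ge0// /H gerBl.
have Hren s : 0 <= s -> H s = d%:R * G 1 s - (d%:R - 1) * conv k H s.
  by move=> s0; rewrite G1//; exact: star_renewal.
have d1 : 1 <= d%:R :> R by rewrite ler1n.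
have d0 : d%:R != 0 :> R by rewrite pnatr_eq0 -lt0n.
have lim := renewal_series k_cont k_ge0 k_le d1 bH bG H1 Grec Hren t_ge0.
pose S n := \sum_(1 <= j < n.+1) (1 - d%:R) ^+ j.-1 * G j t.
have SE : S @ \oo --> d%:R^-1 * H t.
  rewrite (_ : S = fun n => d%:R^-1 * (d%:R * S n)); last first.
    by apply/funext => n; rewrite mulKf.
  by apply: cvgM; [exact: cvg_cst|exact: lim].
have main (S' : nat -> R) : S' = S -> cvgn S' /\ p0 P X t = 1 - d%:R * limn S'.
  move=> ->; split; first by apply/cvg_ex; exists (d%:R^-1 * H t).
  by rewrite (cvg_lim _ SE)// mulVKf// /H subKr.
have cE : c = if mu <= lambda then 1 else 1 - ((mu - lambda) / mu) `^ (alpha / lambda).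
  by [].
case: ifPn => ml; rewrite ?ml ?(negbTE ml) in cE; apply: main; apply/funext => n.
  by apply: eq_bigr => j _; rewrite /G cE expr1n mul1r.
by apply: eq_bigr => j _; rewrite /G cE mulrA.
Qed.
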